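(* Let $\dots\xrightarrow{q_1}Y_1\xrightarrow{q_0}Y_0$ be an inverse sequence of uniformly continuous maps between uniform ANRs, where $Y_0$ is a uniform AR, and let $Y$ be its inverse limit. Let $f\colon X\to Y$ be a uniformly continuous map, where $X$ is the limit of a convergent inverse sequence $\dots\xrightarrow{p_1}X_1\xrightarrow{p_0}X_0$ of uniformly continuous maps between metrizable uniform spaces. Then there exists a uniformly continuous extension $f_{[0,\infty]}\colon X_{[0,\infty]}\to Y_{[0,\infty]}$ of $f$ sending $X_{[0,\infty)}$ into $Y_{[0,\infty)}$. Moreover, every two such extensions are uniformly homotopic through such extensions.
   Context: A uniform AR [uniform ANR] is a metrizable uniform space $Y$ such that for every uniform embedding $i$ of $Y$ onto a closed subspace of a metrizable uniform space $Z$ there exists a uniformly continuous retraction of $Z$ [respectively, of some uniform neighborhood of $i(Y)$ in $Z$] onto $i(Y)$. A uniform neighborhood of a subset $S$ of a metrizable uniform space is a set containing an $\varepsilon$-neighborhood of $S$ for some $\varepsilon>0$. Composite bonding maps are denoted $p^j_i\colon X_j\to X_i$ and projections $p^\infty_i\colon X\to X_i$. Let $X_{\mathbb{N}\cup\infty}$ be the inverse limit of the finite disjoint unions $X_n\sqcup\dots\sqcup X_0$ with bonding maps equal to $p_n$ on $X_{n+1}$ and to the identity on $X_n\sqcup\dots\sqcup X_0$. The inverse sequence is convergent if every uniform neighborhood of its limit $X$ in $X_{\mathbb{N}\cup\infty}$ contains all but finitely many of the $X_i$'s; equivalently, for each $i$, each uniform neighborhood of $p^\infty_i(X)$ in $X_i$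 contains $p^j_i(X_j)$ for all but finitely many $j$. The mapping cylinder $MC(g)$ of a uniformly continuous map $g\colon P\to R$ is the quotient of $P\times[0,1]\sqcup R$ by $(x,1)\sim g(x)$, with the quotient uniformity (the finest pre-uniformity making the quotient map uniformly continuous). For an inverse sequence $Z=(\dots\xrightarrow{g_1}Z_1\xrightarrow{g_0}Z_0)$, the finite mapping telescope is $Z_{[0,m]}=MC(g_0)\cup_{Z_1}MC(g_1)\cup_{Z_2}\dots\cup_{Z_{m-1}}MC(g_{m-1})$ (successive amalgamated unions with quotient uniformity), with the obvious projection to $[0,m]$ sending $MC(g_i)$ onto $[i,i+1]$, $Z_i$ to $i$ and the domain end $Z_{i+1}$ to $i+1$. The extended mapping telescope $Z_{[0,\infty]}$ is the inverse limit of the $Z_{[0,m]}$ along the obvious retractions $Z_{[0,m+1]}\to Z_{[0,m]}$ (collapsing $MC(g_m)$ onto $Z_m$); it has a projection to $[0,\infty]$; its part over $\infty$ is identified with $\varprojlim Z$, and $Z_{[0,\infty)}$ denotes its part over $[0,\infty)$. *)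

(* Defs.v *)
From HB Require Import structures.
From Stdlib Require Import Relation_Operators.
From mathcomp Require Import all_boot all_order all_algebra generic_quotient.
From mathcomp Require Import all_classical all_reals all_analysis.

Set Implicit Arguments.
Unset Strict Implicit.
Unset Printing Implicit Defensive.

Import Order.TTheory GRing.Theory Num.Theory.
Import numFieldNormedType.Exports.

Local Open Scope classical_set_scope.
Local Open Scope ring_scope.
Local Open Scope relation_scope.
Local Open Scope quotient_scope.

(* A [uniformType] need not be Hausdorff, i.e. it is a pre-uniform space; spaces
   that are required to be metrizable carry the following hypothesis. *)
Definition metrizable (R : realType) (U : uniformType) : Prop :=
  exists d : U -> U -> R,
    [/\ forall x y, 0 <= d x y,
        forall x y, d x y = 0 <-> x = y,
        forall x y, d x y = d y x,
        forall x y z, d x z <= d x y + d y z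
      & @entourage U = entourage_ (fun x e => [set y | d x y < e])].

Definition unif_embedding (U V : uniformType) (i : U -> V) : Prop :=
  [/\ injective i, unif_continuous i
    & forall E : set (U * U), entourage E ->
      exists2 F : set (V * V), entourage F &
        forall x y, F (i x, i y) -> E (x, y)].

Definition unif_nbhs (U : uniformType) (S N : set U) : Prop :=
  exists2 E : set (U * U), entourage E &
    forall x y, S x -> E (x, y) -> N y.

Definition unif_retract (U : uniformType) (N A : set U) : Prop :=
  exists r : set_type N -> U,
    [/\ unif_continuous r, forall x, A (r x)
      & forall x, A (set_val x) -> r x = set_val x].

Definition uniform_AR (R : realType) (Y : uniformType) : Prop :=
  metrizable R Y /\
  forall (Z : uniformType) (i : Y -> Z),
    metrizable R Z -> unif_embedding i -> closed (range i) ->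
    unif_retract [set: Z] (range i).

Definition uniform_ANR (R : realType) (Y : uniformType) : Prop :=
  metrizable R Y /\
  forall (Z : uniformType) (i : Y -> Z),
    metrizable R Z -> unif_embedding i -> closed (range i) ->
    exists2 N : set Z, unif_nbhs (range i) N & unif_retract N (range i).

Section InverseLimit.
Variables (X : nat -> uniformType) (p : forall n, X n.+1 -> X n).

Definition invlim_set : set (prod_topology X) :=
  [set x : prod_topology X | forall n, p (x n.+1) = x n].

Definition invlim : Type := set_type invlim_set.

HB.instance Definition _ := Uniform.copy invlim (set_type invlim_set).

Definition invlim_proj (n : nat) (x : invlim) : X n := set_val x n.

Definition invlim_mk (x : forall n, X n) (xP : forall n, p (x n.+1) = x n) :
  invlim := SigSub (mem_set (xP : invlim_set x)).

Lemma invlim_projP (x : invlim) n :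
  p (invlim_proj n.+1 x) = invlim_proj n x.
Proof. exact: (set_valP x n). Qed.

End InverseLimit.

(* The disjoint union, with the coproduct uniformity. *)
Section DisjointUnion.
Variables (U V : uniformType).

Definition dunion : Type := (U + V)%type.

HB.instance Definition _ := Choice.on dunion.

Definition pair_inl (xy : U * U) : dunion * dunion := (inl xy.1, inl xy.2).
Definition pair_inr (xy : V * V) : dunion * dunion := (inr xy.1, inr xy.2).

Definition dunion_ent : set_system (dunion * dunion) :=
  [set E | entourage (pair_inl @^-1` E) /\ entourage (pair_inr @^-1` E)].

Let dunion_ent_filter : Filter dunion_ent.
Proof.
split; rewrite /dunion_ent /=.
- by split; exact: filterT.
- by move=> A B [A1 A2] [B1 B2]; split; exact: filterI.
- by move=> A B AB [A1 A2]; split; [move: A1|move: A2]; apply: filterS => ?;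
    exact: AB.
Qed.

Let dunion_ent_diagonal A : dunion_ent A -> diagonal `<=` A.
Proof.
move=> [A1 A2] [x y] /diagonalP ->; case: y => z.
- exact: (entourage_refl z A1).
- exact: (entourage_refl z A2).
Qed.

Let dunion_ent_inv A : dunion_ent A -> dunion_ent A^-1.
Proof. by move=> [A1 A2]; split; [move: A1|move: A2] => /entourage_inv. Qed.

Let dunion_ent_split A :
  dunion_ent A -> exists2 B, dunion_ent B & B \; B `<=` A.
Proof.
move=> [/entourage_split_ex[B1 eB1 sB1] /entourage_split_ex[B2 eB2 sB2]].
exists [set ab | match ab with
  | (inl a, inl b) => B1 (a, b) | (inr a, inr b) => B2 (a, b) | _ => False end].
  split.
    by apply: filterS eB1 => -[].
  by apply: filterS eB2 => -[].
move=> [[a|a] [b|b]] [[c|c] //= ? ?].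
- by apply: (sB1 (a, b)); exists c.
- by apply: (sB2 (a, b)); exists c.
Qed.

HB.instance Definition _ := @isUniform.Build dunion dunion_ent
  dunion_ent_filter dunion_ent_diagonal dunion_ent_inv dunion_ent_split.

End DisjointUnion.

Definition is_uniformity (T : Type) (E : set_system (T * T)) : Prop :=
  [/\ Filter E,
      forall A, E A -> diagonal `<=` A,
      forall A, E A -> E A^-1
    & forall A, E A -> exists2 B, E B & B \; B `<=` A].

(* The quotient of a uniform space by the equivalence relation generated by [r],
   with the finest uniformity for which the quotient map is uniformly
   continuous. *)
Section UniformQuotient.
Variables (U : uniformType) (r : U -> U -> Prop).

Definition gen_rel : rel U := fun x y => `[< clos_refl_sym_trans U r x y >].

Let gen_rel_refl : reflexive gen_rel.
Proof. by move=> x; apply/asboolP; exact: rst_refl. Qed.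

Let gen_rel_sym : symmetric gen_rel.
Proof. by move=> x y; apply/asboolP/asboolP; exact: rst_sym. Qed.

Let gen_rel_trans : transitive gen_rel.
Proof.
by move=> y x z /asboolP xy /asboolP yz; apply/asboolP; exact: rst_trans xy yz.
Qed.

Definition gen_equiv := EquivRel gen_rel gen_rel_refl gen_rel_sym gen_rel_trans.

Definition uquot : Type := {eq_quot gen_equiv}.

HB.instance Definition _ := Choice.on uquot.
HB.instance Definition _ := Quotient.on uquot.

Definition uquot_pi (x : U) : uquot := \pi_uquot x.

Definition uquot_lift (T : Type) (f : U -> T) (q : uquot) : T := f (repr q).

Lemma uquot_piP x y : uquot_pi x = uquot_pi y <-> clos_refl_sym_trans U r x y.
Proof.
split; first by move/eqmodP/asboolP.
by move=> xy; apply/eqmodP/asboolP.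
Qed.

Lemma uquot_liftE (T : Type) (f : U -> T) :
  (forall x y, r x y -> f x = f y) -> forall x, uquot_lift f (uquot_pi x) = f x.
Proof.
move=> fr x; have : clos_refl_sym_trans U r (repr (uquot_pi x)) x.
  by apply/uquot_piP; rewrite /uquot_pi reprK.
rewrite /uquot_lift; move: (repr _) => y.
by elim=> [a b /fr| |a b _ ->|a b c _ -> _ ->].
Qed.

Definition uquot_pair (xy : U * U) : uquot * uquot :=
  (uquot_pi xy.1, uquot_pi xy.2).

(* The union of all uniformities that make [uquot_pi] uniformly continuous; it
   is itself such a uniformity. *)
Definition uquot_ent : set_system (uquot * uquot) :=
  [set A | exists E : set_system (uquot * uquot),
    [/\ is_uniformity E, uquot_pair @ entourage --> E & E A]].

Let uquot_ent_filter : Filter uquot_ent.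
Proof.
split.
- exists [set setT]; split => //; last by move=> A ->; exact: filterT.
  split.
  + split => // [A B -> ->|A B AB A1]; first by rewrite setTI.
    by rewrite /= -subTset -A1.
  + by move=> A ->.
  + by move=> A ->.
  + by move=> A ->; exists setT.
- move=> A B [E [[FE dE iE sE] cE EA]] [F [[FF dF iF sF] cF FB]].
  exists (filter_from (E `*` F) (fun C => C.1 `&` C.2)); split.
  + split.
    * apply: filter_from_filter.
        by exists (setT, setT); split; exact: filterT.
      move=> [C D] [C' D'] [/= ? ?] [/= ? ?].
      exists (C `&` C', D `&` D'); first by split; exact: filterI.
      by move=> x [[? ?] [? ?]].
    * move=> C [[D D'] [/= ED FD'] sC] x dx; apply: sC; split.
        exact: dE ED _ dx.
      exact: dF FD' _ dx.
    * move=> C [[D D'] [/= ED FD'] sC].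
      exists (D^-1, D'^-1); first by split; [exact: iE|exact: iF].
      by move=> x [? ?]; apply: sC.
    * move=> C [[D D'] [/= /sE[G EG sG] /sF[G' FG' sG']] sC].
      exists (G `&` G'); first by exists (G, G').
      move=> [x y] [z [/= ? ?] [/= ? ?]]; apply: sC; split.
        by apply: sG; exists z.
      by apply: sG'; exists z.
  + move=> C [[D D'] [/= ED FD'] sC].
    apply: (filterS _ (filterI (cE _ ED) (cF _ FD'))) => x [? ?].
    exact: sC.
  + by exists (A, B).
- move=> A B AB [E [UE cE EA]]; exists E; split => //.
  by case: UE => FE _ _ _; exact: filterS EA.
Qed.

Let uquot_ent_diagonal A : uquot_ent A -> diagonal `<=` A.
Proof. by move=> [E [[_ dE _ _] _ /dE]]. Qed.

Let uquot_ent_inv A : uquot_ent A -> uquot_ent A^-1.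
Proof.
by move=> [E [UE cE EA]]; exists E; split => //; case: UE => _ _ + _; apply.
Qed.

Let uquot_ent_split A :
  uquot_ent A -> exists2 B, uquot_ent B & B \; B `<=` A.
Proof.
move=> [E [UE cE EA]]; have [_ _ _ /(_ _ EA)[B EB sB]] := UE.
by exists B => //; exists E.
Qed.

HB.instance Definition _ := @isUniform.Build uquot uquot_ent
  uquot_ent_filter uquot_ent_diagonal uquot_ent_inv uquot_ent_split.

Lemma uquot_pi_unif_continuous : unif_continuous uquot_pi.
Proof. by move=> A [E [_ cE EA]]; exact: cE. Qed.

Lemma uquot_ent_finest (E : set_system (uquot * uquot)) :
  is_uniformity E -> uquot_pair @ entourage --> E -> E `<=` entourage.
Proof. by move=> UE cE A EA; exists E. Qed.

End UniformQuotient.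

Definition unit_interval (R : realType) : Type :=
  set_type [set t : R | 0 <= t <= 1].

HB.instance Definition _ (R : realType) :=
  Uniform.copy (unit_interval R) (set_type [set t : R | 0 <= t <= 1]).

Definition ui_val (R : realType) (t : unit_interval R) : R := set_val t.

Definition ui_mk (R : realType) (t : R) (tP : 0 <= t <= 1) : unit_interval R :=
  SigSub (mem_set (tP : [set t : R | 0 <= t <= 1] t)).

Definition ui0 (R : realType) : unit_interval R :=
  ui_mk (introT andP (conj (lexx 0) ler01)).

Definition ui1 (R : realType) : unit_interval R :=
  ui_mk (introT andP (conj ler01 (lexx 1))).

Section MappingCylinder.
Variables (R : realType) (P Q : uniformType) (g : P -> Q).

Definition mc_pre : uniformType := dunion (P * unit_interval R)%type Q.

Definition mc_glue (a b : mc_pre) : Prop :=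
  exists x : P, a = inl (x, ui1 R) /\ b = inr (g x).

Definition mcyl : uniformType := uquot mc_glue.

Definition mc_seg (x : P) (t : unit_interval R) : mcyl :=
  uquot_pi mc_glue (inl (x, t)).

Definition mc_base (y : Q) : mcyl := uquot_pi mc_glue (inr y).

Definition mc_collapse : mcyl -> Q :=
  uquot_lift (fun a : mc_pre =>
    match a with inl xt => g xt.1 | inr y => y end).

Definition mc_height : mcyl -> R :=
  uquot_lift (fun a : mc_pre =>
    match a with inl xt => 1 - ui_val xt.2 | inr _ => 0 end).

Lemma mc_glueE (x : P) : mc_seg x (ui1 R) = mc_base (g x).
Proof. by apply/uquot_piP/rst_step; exists x. Qed.

Lemma mc_collapse_seg x t : mc_collapse (mc_seg x t) = g x.
Proof. by rewrite /mc_collapse uquot_liftE // => _ _ [y [-> ->]]. Qed.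

Lemma mc_collapse_base y : mc_collapse (mc_base y) = y.
Proof. by rewrite /mc_collapse uquot_liftE // => _ _ [x [-> ->]]. Qed.

Let mc_heightP (a b : mc_pre) : mc_glue a b ->
  match a with inl xt => 1 - ui_val xt.2 | inr _ => 0 end =
  match b with inl xt => 1 - ui_val xt.2 | inr _ => 0 end.
Proof. by move=> [y [-> ->]]; rewrite /ui_val /= subrr. Qed.

Lemma mc_height_seg x t : mc_height (mc_seg x t) = 1 - ui_val t.
Proof. by rewrite /mc_height uquot_liftE. Qed.

Lemma mc_height_base y : mc_height (mc_base y) = 0.
Proof. by rewrite /mc_height uquot_liftE. Qed.

Lemma mcyl_ind (S : mcyl -> Prop) :
  (forall x t, S (mc_seg x t)) -> (forall y, S (mc_base y)) -> forall c, S c.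
Proof.
move=> Sseg Sbase c; rewrite -(reprK c).
by case: (repr c) => [[x t]|y]; [exact: Sseg|exact: Sbase].
Qed.

Lemma mc_seg0_inj : injective (mc_seg^~ (ui0 R)).
Proof.
pose h (a : mc_pre) : option P :=
  if a is inl (x, t) then if ui_val t == 0 then Some x else None else None.
have hP (a b : mc_pre) : mc_glue a b -> h a = h b.
  by move=> [x [-> ->]]; rewrite /h /ui_val /= oner_eq0.
have hE x : uquot_lift h (mc_seg x (ui0 R)) = Some x.
  by rewrite uquot_liftE // /h /ui_val /= eqxx.
by move=> x y /(congr1 (uquot_lift h)); rewrite !hE => -[].
Qed.

End MappingCylinder.

Section AmalgamatedUnion.
Variables (A B C : uniformType) (i : C -> A) (j : C -> B).

Definition am_glue (a b : dunion A B) : Prop :=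
  exists c : C, a = inl (i c) /\ b = inr (j c).

Definition amalg : uniformType := uquot am_glue.

Definition am_inl (a : A) : amalg := uquot_pi am_glue (inl a).

Definition am_inr (b : B) : amalg := uquot_pi am_glue (inr b).

Definition am_rec (T : Type) (f : A -> T) (h : B -> T) : amalg -> T :=
  uquot_lift (fun a : dunion A B =>
    match a with inl x => f x | inr y => h y end).

Lemma am_glueE c : am_inl (i c) = am_inr (j c).
Proof. by apply/uquot_piP/rst_step; exists c. Qed.

Lemma am_rec_inl (T : Type) (f : A -> T) (h : B -> T) :
  f \o i =1 h \o j -> forall a, am_rec f h (am_inl a) = f a.
Proof.
move=> fh a; rewrite /am_rec uquot_liftE // => _ _ [c [-> ->]]; exact: fh.
Qed.

Lemma am_rec_inr (T : Type) (f : A -> T) (h : B -> T) :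
  f \o i =1 h \o j -> forall b, am_rec f h (am_inr b) = h b.
Proof.
move=> fh b; rewrite /am_rec uquot_liftE // => _ _ [c [-> ->]]; exact: fh.
Qed.

Lemma amalg_ind (S : amalg -> Prop) :
  (forall a, S (am_inl a)) -> (forall b, S (am_inr b)) -> forall c, S c.
Proof.
move=> Sl Sr c; rewrite -(reprK c).
by case: (repr c) => [a|b]; [exact: Sl|exact: Sr].
Qed.

End AmalgamatedUnion.

Section Telescope.
Variables (R : realType) (Z : nat -> uniformType)
  (g : forall n, Z n.+1 -> Z n).

(* The space Z_[0,m] with the embedding of Z_m as its far end and the projection
   to [0,m]. *)
Record tel_stage (m : nat) := TelStage {
  tel_space : uniformType;
  tel_end : Z m -> tel_space;
  tel_height : tel_space -> R }.

Fixpoint telescope (m : nat) : tel_stage m :=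
  match m return tel_stage m with
  | 0%N => @TelStage 0 (Z 0) id (fun=> 0)
  | k.+1 =>
    let T := telescope k in
    let M := mcyl R (g (n := k)) in
    @TelStage k.+1 (amalg (@tel_end k T) (@mc_base R _ _ (g (n := k))))
      (fun z => am_inr (@tel_end k T) (@mc_base R _ _ (g (n := k)))
                  (mc_seg (g (n := k)) z (ui0 R)))
      (am_rec (@tel_height k T) (fun c : M => k%:R + mc_height c))
  end.

Definition tel (m : nat) : uniformType := tel_space (telescope m).

Definition tel_retr (m : nat) : tel m.+1 -> tel m :=
  am_rec id (fun c : mcyl R (g (n := m)) =>
               tel_end (telescope m) (mc_collapse c)).

Definition tel_ext : uniformType := invlim tel_retr.

Let tel_retr_compat m :
  id \o tel_end (telescope m) =1
  (fun c : mcyl R (g (n := m)) => tel_end (telescope m) (mc_collapse c))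
    \o (@mc_base R _ _ (g (n := m))).
Proof. by move=> z /=; rewrite mc_collapse_base. Qed.

Lemma tel_retr_end m z :
  tel_retr (tel_end (telescope m.+1) z) = tel_end (telescope m) (g z).
Proof.
rewrite /tel_retr /= am_rec_inr ?mc_collapse_seg //; exact: tel_retr_compat.
Qed.

Lemma tel_inf_proof (z : invlim g) n :
  tel_retr (tel_end (telescope n.+1) (invlim_proj n.+1 z)) =
  tel_end (telescope n) (invlim_proj n z).
Proof. by rewrite tel_retr_end invlim_projP. Qed.

(* The identification of the limit of Z with the part of Z_[0,oo] over oo. *)
Definition tel_inf (z : invlim g) : tel_ext :=
  @invlim_mk _ tel_retr (fun n => tel_end (telescope n) (invlim_proj n z))
    (tel_inf_proof z).

(* The projection to [0,oo]: a point of Z_[0,oo] lying over t has its component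
   in Z_[0,m] over min(t,m). *)
Definition tel_ext_height (x : tel_ext) : \bar R :=
  ereal_sup (range (fun m => (tel_height (invlim_proj m x))%:E)).

Definition tel_fin : set tel_ext := [set x | (tel_ext_height x < +oo)%E].

Lemma tel_height_end m z : tel_height (tel_end (telescope m) z) = m%:R.
Proof.
elim: m z => [//|m IH] z; rewrite /= am_rec_inr => [|z' /=].
  by rewrite mc_height_seg /ui_val /= subr0 -natr1.
by rewrite mc_height_base addr0.
Qed.

Let tel_height_compat m :
  @tel_height m (telescope m) \o tel_end (telescope m) =1
  (fun c : mcyl R (g (n := m)) => m%:R + mc_height c)
    \o (@mc_base R _ _ (g (n := m))).
Proof. by move=> z /=; rewrite tel_height_end mc_height_base addr0. Qed.

Lemma tel_height_le m (x : tel m) : tel_height x <= m%:R.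
Proof.
elim: m x => [x|m IH]; first exact: lexx.
apply: amalg_ind => [a|].
  rewrite /= am_rec_inl; last exact: tel_height_compat.
  by rewrite (le_trans (IH a)) // ler_nat.
apply: mcyl_ind => [z t|z]; rewrite /= am_rec_inr; try exact: tel_height_compat.
  rewrite mc_height_seg -natr1 lerD2l gerBl.
  by have /andP[] := set_valP t.
by rewrite mc_height_base addr0 ler_nat.
Qed.

Lemma tel_height_retr m (x : tel m.+1) :
  tel_height (tel_retr x) = Num.min (tel_height x) m%:R.
Proof.
elim/amalg_ind: x => [a|c].
  rewrite /= am_rec_inl; last exact: tel_height_compat.
  rewrite /tel_retr am_rec_inl; last exact: tel_retr_compat.
  by apply/esym/min_idPl; exact: tel_height_le.
rewrite /= am_rec_inr; last exact: tel_height_compat.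
rewrite /tel_retr am_rec_inr; last exact: tel_retr_compat.
rewrite tel_height_end; apply/esym/min_idPr; rewrite lerDl.
elim/mcyl_ind: c => [z t|z]; last by rewrite mc_height_base.
by rewrite mc_height_seg subr_ge0; have /andP[] := set_valP t.
Qed.

Lemma tel_height_max m (x : tel m) :
  tel_height x = m%:R -> exists z, x = tel_end (telescope m) z.
Proof.
case: m x => [x _|m]; first by exists x.
apply: amalg_ind => [a|].
  rewrite /= am_rec_inl; last exact: tel_height_compat.
  by move=> am; have := tel_height_le a; rewrite am ler_nat ltnn.
apply: mcyl_ind => [z t|z]; rewrite /= am_rec_inr; try exact: tel_height_compat.
  rewrite mc_height_seg -natr1 => /addrI t0; exists z; congr (am_inr _ _ _).
  congr mc_seg; apply: val_inj => /=.
  by move: t0 => /eqP; rewrite -subr_eq0 addrAC subrr add0r oppr_eq0 => /eqP.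
rewrite mc_height_base addr0 => /eqP; rewrite eqr_nat => /eqP.
by move/n_Sn.
Qed.

Lemma tel_end_inj m : injective (tel_end (telescope m)).
Proof.
case: m => [//|m] x y xy.
pose h := am_rec (i := tel_end (telescope m)) (j := @mc_base R _ _ (g (n := m)))
  (fun=> None) (fun c => if mc_height c == 1 then Some c else None).
have hP z : h (tel_end (telescope m.+1) z) = Some (mc_seg (g (n := m)) z (ui0 R)).
  rewrite /h /= am_rec_inr => [|z' /=].
    by rewrite mc_height_seg /ui_val /= subr0 eqxx.
  by rewrite mc_height_base eq_sym oner_eq0.
by have := congr1 h xy; rewrite !hP => -[] /mc_seg0_inj.
Qed.

Lemma tel_finE : @tel_fin = ~` range tel_inf.
Proof.
apply/seteqP; split => [x xfin [z _ zx]|x xNinf].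
  move: xfin; rewrite /tel_fin /= -zx; apply/negP; rewrite -leNgt leye_eq.
  apply/eqP/eq_infty => t; apply: le_ereal_sup_tmp.
  exists ((Num.truncn t).+1%:R)%:E; last by rewrite lee_fin ltW // truncnS_gt.
  by exists (Num.truncn t).+1 => //; rewrite tel_height_end.
have [hx|] := pselect (forall m, tel_height (invlim_proj m x) = m%:R).
  exfalso; apply: xNinf.
  pose z m := sval (cid (tel_height_max (hx m))).
  have zP m : invlim_proj m x = tel_end (telescope m) (z m).
    exact: svalP (cid (tel_height_max (hx m))).
  have zg n : g (z n.+1) = z n.
    by apply: tel_end_inj; rewrite -tel_retr_end -!zP invlim_projP.
  exists (invlim_mk zg) => //; apply: val_inj; apply: functional_extensionality_dep => n.
  exact/esym/zP.
move=> /existsNP[m /eqP hm].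
have {}hm : tel_height (invlim_proj m x) < m%:R by rewrite lt_neqAle hm tel_height_le.
have hS k : tel_height (invlim_proj k x) =
    Num.min (tel_height (invlim_proj k.+1 x)) k%:R.
  by rewrite -tel_height_retr invlim_projP.
have hge k : (m <= k)%N ->
    tel_height (invlim_proj k x) = tel_height (invlim_proj m x).
  elim: k => [|k IH]; first by rewrite leqn0 => /eqP->.
  rewrite leq_eqVlt => /predU1P[->//|]; rewrite ltnS => mk.
  have hk := IH mk.
  move: (hS k); rewrite minEle; case: ifPn => [_ <- //|_ e].
  by move: hm; rewrite -hk e ltr_nat ltnNge mk.
have hmono k l : (k <= l)%N ->
    tel_height (invlim_proj k x) <= tel_height (invlim_proj l x).
  elim: l => [|l IH]; first by rewrite leqn0 => /eqP->.
  rewrite leq_eqVlt => /predU1P[->//|/IH kl]; apply: le_trans kl _.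
  by rewrite hS ge_min lexx.
rewrite /tel_fin /= (le_lt_trans _ (ltry (tel_height (invlim_proj m x)))) //.
apply: ge_ereal_sup => _ [k _ <-]; rewrite lee_fin.
by have [/hmono//|/ltnW/hge->] := leqP k m.
Qed.

End Telescope.

Section Convergence.
Variables (X : nat -> uniformType) (p : forall n, X n.+1 -> X n).

Fixpoint du (n : nat) : uniformType :=
  match n with 0%N => X 0 | k.+1 => dunion (X k.+1) (du k) end.

Definition du_top (n : nat) : X n -> du n :=
  match n return X n -> du n with 0%N => id | k.+1 => @inl _ _ end.

Definition du_bond (n : nat) (a : du n.+1) : du n :=
  match a with inl x => du_top (p x) | inr b => b end.

(* X_{N u oo} *)
Definition du_lim : uniformType := invlim du_bond.

Lemma du_inf_proof (x : invlim p) n :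
  du_bond (du_top (invlim_proj n.+1 x)) = du_top (invlim_proj n x).
Proof. by rewrite /= invlim_projP. Qed.

Definition du_inf (x : invlim p) : du_lim :=
  @invlim_mk _ du_bond (fun n => du_top (invlim_proj n x)) (du_inf_proof x).

(* The copy of X_i in X_{N u oo}: the threads that lie in the summand X_i at
   stage i, and from then on stay in the part fixed by the bonding maps. *)
Definition du_piece (i : nat) : set du_lim :=
  [set w | range (@du_top i) (invlim_proj i w) /\
           forall n, (i <= n)%N -> invlim_proj n.+1 w = inr (invlim_proj n w)].

Lemma du_pieceP i (x : X i) :
  exists! w, du_piece i w /\ invlim_proj i w = du_top x.
Proof.
have thread (a : du i) : exists w : forall n, du n,
    [/\ forall n, du_bond (w n.+1) = w n, w i = a
      & forall n, (i <= n)%N -> w n.+1 = inr (w n)].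
  elim: i a {x} => [|i IH] a.
    by exists (fix w n : du n :=
      if n is k.+1 return du n then inr (w k) else a).
  have [v [vP va vr]] := IH (du_bond a); pose v' := eqtype.dfwith (T := fun n => du n) v (i := i.+1) a.
  pose w := fix w n : du n :=
    if n is k.+1 return du n then if (k <= i)%N then v' k.+1 else inr (w k)
    else v' 0%N.
  have wv n : (n <= i.+1)%N -> w n = v' n.
    by case: n => [//|n]; rewrite ltnS /= => ->.
  have wo n : (n <= i)%N -> w n = v n.
    by move=> ni; rewrite wv ?leqW // /v' dfwith_out // gtn_eqF.
  have wi : w i.+1 = a by rewrite wv // /v' dfwith_in.
  have wr n : (i < n)%N -> w n.+1 = inr (w n).
    by move=> ni; rewrite [LHS]/= leqNgt ni.
  exists w; split => // n; case: (ltngtP n i) => [ni|ni|->].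
  - by rewrite (wo _ ni) (wo _ (ltnW ni)).
  - by rewrite wr.
  - by rewrite wi wo.
have [w [wP wi wr]] := thread (du_top x).
exists (@invlim_mk _ du_bond w wP); split.
  by split=> //; split=> //; exists x.
move=> u [[_ ur] ui]; apply: val_inj; apply: functional_extensionality_dep => n.
have up k : invlim_proj (i + k) u = w (i + k)%N.
  elim: k => [|k IH]; first by rewrite addn0 ui wi.
  by rewrite addnS ur ?leq_addr // IH wr ?leq_addr.
have down k l : (k <= l)%N -> invlim_proj l u = w l -> invlim_proj k u = w k.
  elim: l => [|l IH]; first by rewrite leqn0 => /eqP->.
  rewrite leq_eqVlt => /predU1P[->//|kl] ul; apply: IH => //.
  by rewrite -wP -ul invlim_projP.
by apply/esym; apply: down (up n); rewrite leq_addl.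
Qed.

Definition convergent : Prop :=
  forall N : set du_lim, unif_nbhs (range du_inf) N ->
    \forall i \near \oo, du_piece i `<=` N.

End Convergence.

Section Extensions.
Variables (R : realType) (X Y : nat -> uniformType).
Variables (p : forall n, X n.+1 -> X n) (q : forall n, Y n.+1 -> Y n).
Variable f : invlim p -> invlim q.

Definition telescope_extension (F : tel_ext R p -> tel_ext R q) : Prop :=
  [/\ unif_continuous F,
      forall x, F (tel_inf R x) = tel_inf R (f x)
    & forall x, tel_fin x -> tel_fin (F x)].

Definition unif_homotopic_extensions (F G : tel_ext R p -> tel_ext R q) :
    Prop :=
  exists H : tel_ext R p * unit_interval R -> tel_ext R q,
    [/\ unif_continuous H,
        forall x, H (x, ui0 R) = F x,
        forall x, H (x, ui1 R) = G x
      & forall t, telescope_extension (fun x => H (x, t))].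

End Extensions.

(* Main.v *)
Require Import Defs.
From HB Require Import structures.
From mathcomp Require Import all_boot all_order all_algebra.
From mathcomp Require Import all_classical all_reals all_analysis.
From mathcomp Require Import finmap lra ring.

(** The proof is one relative extension theorem, applied twice.

    Extension theorem ([tel_ext_extension]): let T be a pseudometric space, let
    b >= 0 be a uniformly continuous function on T and B its zero set.  Every
    uniformly continuous map B -> Y_[0,oo] extends to a uniformly continuous map
    T -> Y_[0,oo] that sends T - B into Y_[0,oo).  For the existence of the
    extension of f, take T = X_[0,oo] and let b be the distance to X.  For the
    homotopy between F and G, take T = X_[0,oo] x [0,1] and let B be the union of
    X x [0,1] and the two ends, on which the constant homotopy of f and F and G
    prescribe the map.  A point that is not over X has a finite image: on the ends
    because F and G are extensions of f, and off B by the theorem.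

    Everything is done with explicit pseudometrics.  Quotient uniformities enter
    only through [tel_metrizes]: Y_[0,m+1] is the mapping cylinder of
    Y_{m+1} -> Y_m -> Y_[0,m], and its uniformity is metrized by
    d(r,r') + |l - l'| + min(l,l') d(y,y'), where r is the retraction to Y_[0,m],
    l in [0,1] is the level above it, and y is the coordinate in Y_{m+1}, defined
    where l > 0.  So a uniformly continuous map into Y_[0,m+1] is a triple
    (r, l, y) in which r and l are uniformly continuous, y is uniformly
    continuous on each set {l >= eps}, and r is the image of y where l > 0.

    The hypothesis that Y_n is a uniform ANR is used for one ambient space only.
    Embed Y_n by Kuratowski's map into the real functions on Y_n and put Y_n at
    the bottom of the collar Y_n x {0} u (functions) x {t <> 0}.  There Y_n is
    closed even when it is not complete, so a uniform neighborhood of it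
    uniformly retracts onto it ([uniform_ANR_retraction]).  Real functions extend
    with their modulus of continuity ([mcshane]); adding the distance to B as the
    collar coordinate and retracting, one extends maps into Y_n near B.  Done on
    the scaled functions l d(y,.), with the level lowered wherever one leaves the
    neighborhood, this extends pairs (l, y) as above ([cone_extensor]).

    The key step is [cyl_lift]: given a map c : T -> Y_[0,m] that extends the
    retraction of a map B -> Y_[0,m+1], there is an extension
    T -> Y_[0,m+1] of the latter whose retraction is as close to c as desired and
    which equals c wherever b is at least a prescribed positive number.  Near B,
    the image in Y_[0,m] of the extended pair (l, y) is close to c but need not
    equal it; the gap is closed by moving c along a path depending uniformly on
    its ends ([connector]), which exists since Y_[0,m] is inductively an absolute
    extensor, and which is short where the level is small.  Iterating [cyl_lift]
    with closeness 2^-m gives maps T -> Y_[0,m] that converge uniformly; at a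
    point of T - B they are eventually carried along by the inclusions, so that
    the limit exists without completeness and is finite there. *)

Set Implicit Arguments.
Unset Strict Implicit.
Unset Printing Implicit Defensive.

Import Order.TTheory GRing.Theory Num.Theory.
Import numFieldNormedType.Exports.

Local Open Scope classical_set_scope.
Local Open Scope ring_scope.

(** * Pseudometrics and uniform continuity *)

Section Pseudometrics.
Variable R : realType.

Definition pseudometric (T : Type) (d : T -> T -> R) : Prop :=
  [/\ forall x y, 0 <= d x y, forall x, d x x = 0,
      forall x y, d x y = d y x & forall x y z, d x z <= d x y + d y z].

Definition unif_cont_on (T V : Type) (d : T -> T -> R) (e : V -> V -> R)
    (S : set T) (f : T -> V) : Prop :=
  forall eps, 0 < eps -> exists2 del, 0 < del &
    forall x y, S x -> S y -> d x y < del -> e (f x) (f y) < eps.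

Definition rdist (a b : R) : R := `|a - b|.

End Pseudometrics.

Arguments rdist {R} a b.

(** * Extension of real functions *)

Section RealFunctions.
Variable R : realType.

Lemma inf_nneg (A : set R) : A !=set0 -> (forall a, A a -> 0 <= a) ->
  (forall a, A a -> inf A <= a) /\ (forall c, (forall a, A a -> c <= a) -> c <= inf A).
Proof.
move=> A0 Ap; split=> [a Aa|c cA]; last exact: lb_le_inf.
by apply: ge_inf => //; exists 0 => b /Ap.
Qed.

Lemma inf_nneg_adherent (A : set R) e : A !=set0 -> (forall a, A a -> 0 <= a) ->
  inf A < e -> exists2 a, A a & a < e.
Proof.
move=> A0 Ap ie; apply: contrapT => H; have [_ /(_ e)] := inf_nneg A0 Ap.
move/(_ _)/le_lt_trans => /(_ _ _ ie); rewrite ltxx => /(_ _)/notF; apply.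
by move=> a Aa; rewrite leNgt; apply/negP => ae; apply: H; exists a.
Qed.

Lemma ler_dist (a b c : R) : a - b <= c -> b - a <= c -> `|a - b| <= c.
Proof. by move=> ? ?; rewrite ler_norml; apply/andP; split; lra. Qed.

Lemma lt_dist (a b c : R) : `|a - b| < c -> a - b < c /\ b - a < c.
Proof. by rewrite ltr_norml => /andP[? ?]; split; lra. Qed.

Lemma dist_min_lt (a b a' b' e : R) : `|a - a'| < e -> `|b - b'| < e ->
  `|Num.min a b - Num.min a' b'| < e.
Proof.
move=> /lt_dist[? ?] /lt_dist[? ?]; rewrite !minEle ltr_norml.
by do 2 (case: ifPn; rewrite -?ltNge => ?); apply/andP; split; lra.
Qed.

Lemma dist_max_lt (a b a' b' e : R) : `|a - a'| < e -> `|b - b'| < e ->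
  `|Num.max a b - Num.max a' b'| < e.
Proof.
move=> /lt_dist[? ?] /lt_dist[? ?]; rewrite !maxEle ltr_norml.
by do 2 (case: ifPn; rewrite -?ltNge => ?); apply/andP; split; lra.
Qed.

Section McShane.
Variables (T : Type) (d : T -> T -> R) (B : set T) (S : Type) (F : S -> T -> R).
Hypothesis dP : pseudometric d.
Hypothesis F01 : forall s x, B x -> 0 <= F s x <= 1.

(** An equicontinuous family bounded by 1 is 1-Lipschitz for the pseudometric
    inf over eps of [eps + d x y / delta eps], where [delta] is its modulus of
    continuity.  Each term is affine in [d], which gives the triangle inequality:
    of two terms, the one of smaller slope, taken at the sum of the two distances,
    is at most the sum of both. *)
Lemma modulus_pseudometric :
  (forall eps, 0 < eps -> exists2 del, 0 < del &
    forall s x y, B x -> B y -> d x y < del -> `|F s x - F s y| < eps) ->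
  exists rho : T -> T -> R,
  [/\ pseudometric rho,
      forall eps, 0 < eps -> exists2 del, 0 < del &
        forall x y, d x y < del -> rho x y < eps
    & forall s x y, B x -> B y -> F s x - F s y <= rho x y].
Proof.
case: dP => d0 dxx ds dt Fuc.
have /boolp.choice[w wP] : forall e : R, exists w : R, 0 < e -> 0 < w /\
    forall s x y, B x -> B y -> d x y < w -> `|F s x - F s y| < e.
  move=> e; have [/Fuc[w w0 H]|/negP] := boolP (0 < e); last by exists 0.
  by exists w.
pose A x y : set R := [set e + d x y / w e | e in [set e | 0 < e]].
have A0 x y : A x y !=set0 by exists (1 + d x y / w 1); exists 1 => //=.
have Ap x y a : A x y a -> 0 <= a.
  move=> [e /= e0 <-]; rewrite addr_ge0 ?divr_ge0//; first exact: ltW.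
  by rewrite ltW // (wP _ e0).1.
have small x y e : 0 < e -> d x y < e * w e -> inf (A x y) < 2 * e.
  move=> e0 dxy; have [we0 _] := wP _ e0.
  apply: (@le_lt_trans _ _ (e + d x y / w e)).
    by apply: (inf_nneg (A0 x y) (@Ap x y)).1; exists e.
  have : d x y / w e < e by rewrite ltr_pdivrMr.
  by lra.
exists (fun x y => inf (A x y)); split; first split.
- by move=> x y; apply: (inf_nneg (A0 x y) (@Ap x y)).2 => a; exact: Ap.
- move=> x; apply/eqP; rewrite eq_le; apply/andP; split; last first.
    by apply: (inf_nneg (A0 x x) (@Ap x x)).2 => a; exact: Ap.
  rewrite leNgt; apply/negP => i0.
  have i20 : 0 < inf (A x x) / 2 by lra.
  have /(_ _) := @small x x _ i20; rewrite dxx mulr_gt0 //; last exact: (wP _ i20).1.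
  by move=> /(_ isT); lra.
- by move=> x y; rewrite /A ds.
- move=> x y z.
  have H1 a b : A x y a -> A y z b -> inf (A x z) <= a + b.
    move=> [e /= e0 <-] [e' /= e'0 <-].
    have [w0 _] := wP _ e0; have [w'0 _] := wP _ e'0.
    have xz := dt x y z; have xy0 := d0 x y; have yz0 := d0 y z.
    have [le_ww|/ltW le_ww] := leP (w e) (w e').
      apply: (@le_trans _ _ (e' + d x z / w e')).
        by apply: (inf_nneg (A0 x z) (@Ap x z)).1; exists e'.
      have h1 : d x y / w e' <= d x y / w e.
        by apply: ler_wpM2l => //; rewrite lef_pV2.
      have h2 : d x z / w e' <= (d x y + d y z) / w e'.
        by apply: ler_wpM2r => //; rewrite invr_ge0 ltW.
      by rewrite mulrDl in h2; lra.
    apply: (@le_trans _ _ (e + d x z / w e)).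
      by apply: (inf_nneg (A0 x z) (@Ap x z)).1; exists e.
    have h1 : d y z / w e <= d y z / w e'.
      by apply: ler_wpM2l => //; rewrite lef_pV2.
    have h2 : d x z / w e <= (d x y + d y z) / w e.
      by apply: ler_wpM2r => //; rewrite invr_ge0 ltW.
    by rewrite mulrDl in h2; lra.
  rewrite -lerBlDr; apply: (inf_nneg (A0 x y) (@Ap x y)).2 => a Aa.
  rewrite lerBlDr -lerBlDl; apply: (inf_nneg (A0 y z) (@Ap y z)).2 => b Ab.
  by rewrite lerBlDl H1.
- move=> e e0; have e20 : 0 < e / 2 by lra.
  exists (e / 2 * w (e / 2)); first by rewrite mulr_gt0 // (wP _ e20).1.
  by move=> x y /(small _ _ _ e20); lra.
- move=> s x y Bx By; apply: (inf_nneg (A0 x y) (@Ap x y)).2 => a [e /= e0 <-].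
  have [w0 H] := wP _ e0.
  have := F01 s Bx; have := F01 s By => /andP[? ?] /andP[? ?].
  have [/(H s _ _ Bx By) /lt_dist[? _]|wd] := ltP (d x y) (w e).
    have : 0 <= d x y / w e by rewrite divr_ge0 // ltW.
    by lra.
  have : 1 <= d x y / w e by rewrite ler_pdivlMr // mul1r.
  by lra.
Qed.

Variable rho : T -> T -> R.
Hypothesis rhoP : pseudometric rho.

(** McShane's formula: [G s x] is the infimum of [F s b + rho x b], cut off at
    1, which also serves the case of an empty [B]. *)
Lemma mcshane : (forall s x y, B x -> B y -> F s x - F s y <= rho x y) ->
  exists G : S -> T -> R,
  [/\ forall s x, 0 <= G s x <= 1, forall s x, B x -> G s x = F s x
    & forall s x y, `|G s x - G s y| <= rho x y].
Proof.
case: rhoP => d0 dxx ds dt FL.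
pose A s x : set R := [set 1] `|` [set F s b + rho x b | b in B].
have A0 s x : A s x !=set0 by exists 1; left.
have Ap s x a : A s x a -> 0 <= a.
  move=> [->//|[b Bb <-]]; rewrite addr_ge0 //.
  by have /andP[] := F01 s Bb.
have lb s x := (inf_nneg (A0 s x) (@Ap s x)).1.
have glb s x := (inf_nneg (A0 s x) (@Ap s x)).2.
exists (fun s x => inf (A s x)); split.
- move=> s x; apply/andP; split; first by apply: glb => a; exact: Ap.
  by apply: lb; left.
- move=> s x Bx; apply/eqP; rewrite eq_le; apply/andP; split.
    by apply: lb; right; exists x => //; rewrite dxx addr0.
  apply: glb => a [->|[b Bb <-]]; first by have /andP[] := F01 s Bx.
  by have := FL s _ _ Bx Bb; lra.
- have H s x y : inf (A s x) <= inf (A s y) + rho x y.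
    rewrite -lerBlDr; apply: glb => a [->|[b Bb <-]].
      have : inf (A s x) <= 1 by apply: lb; left.
      by have := d0 x y; lra.
    have : inf (A s x) <= F s b + rho x b by apply: lb; right; exists b.
    by have := dt x y b; lra.
  move=> s x y; apply: ler_dist; first by have := H s x y; lra.
  by have := H s y x; rewrite ds; lra.
Qed.

(** The distance to [B], cut off at 1. *)
Lemma dist_fun : exists D : T -> R,
  [/\ forall x, 0 <= D x, forall x, B x -> D x = 0,
      forall x y, `|D x - D y| <= rho x y
    & forall x a, D x < a -> a <= 1 -> exists2 b, B b & rho x b < a].
Proof.
case: rhoP => d0 dxx ds dt.
pose A x : set R := [set 1] `|` [set rho x b | b in B].
have A0 x : A x !=set0 by exists 1; left.
have Ap x a : A x a -> 0 <= a by move=> [->//|[b Bb <-]].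
have lb x := (inf_nneg (A0 x) (@Ap x)).1.
have glb x := (inf_nneg (A0 x) (@Ap x)).2.
exists (fun x => inf (A x)); split.
- by move=> x; apply: glb => a; exact: Ap.
- move=> x Bx; apply/eqP; rewrite eq_le; apply/andP; split.
    by apply: lb; right; exists x.
  by apply: glb => a; exact: Ap.
- have H x y : inf (A x) <= inf (A y) + rho x y.
    rewrite -lerBlDr; apply: glb => a [->|[b Bb <-]].
      have : inf (A x) <= 1 by apply: lb; left.
      by have := d0 x y; lra.
    have : inf (A x) <= rho x b by apply: lb; right; exists b.
    by have := dt x y b; lra.
  move=> x y; apply: ler_dist; first by have := H x y; lra.
  by have := H y x; rewrite ds; lra.
- move=> x a Dx a1; have [b [->|[c Bc <-]] ba] := inf_nneg_adherent (A0 x) (@Ap x) Dx.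
    by lra.
  by exists c.
Qed.

End McShane.
End RealFunctions.

(** * Extension of maps into a neighborhood retract and into its cone *)

Section Cone.
Variable R : realType.

Definition kuratowski (P : Type) (d : P -> P -> R) (y : P) (s : option P) : R :=
  if s is Some p then d y p else 0.

(** The functions [w] on [option P] stand for pairs (function on P, collar
    coordinate [w None]); the collar contains every pair whose coordinate is
    nonzero and, at coordinate 0, the Kuratowski image of P only.  This makes P
    closed in it whether or not P is complete. *)
Definition collar (P : Type) (d : P -> P -> R) (w : option P -> R) : Prop :=
  w None = 0 -> exists y, w = kuratowski d y.

Definition near_kuratowski (P : Type) (d : P -> P -> R) (e : R) (w : option P -> R) : Prop :=
  exists y, forall s, `|w s - kuratowski d y s| < e.

(** A retraction of [N], within the collar, onto the copy of P at coordinate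
    0, as a total function; uniform continuity refers to the sup distance. *)
Definition collar_retraction (P : Type) (d : P -> P -> R)
    (N : set (option P -> R)) (r : (option P -> R) -> P) : Prop :=
  (forall y, r (kuratowski d y) = y) /\
  forall eps, 0 < eps -> exists2 del, 0 < del & forall w w',
    collar d w -> collar d w' -> N w -> N w' ->
    (forall s, `|w s - w' s| < del) -> d (r w) (r w') < eps.

(** The closed subset from which maps extend is given as the zero set of a
    uniformly continuous function. *)
Definition absolute_extensor (V : Type) (dV : V -> V -> R) : Prop :=
  forall (T : Type) (d : T -> T -> R) (b : T -> R) (f : T -> V),
    pseudometric d -> (forall x, 0 <= b x) ->
    unif_cont_on d rdist setT b ->
    unif_cont_on d dV [set x | b x = 0] f ->
    exists2 g : T -> V, unif_cont_on d dV setT g & forall x, b x = 0 -> g x = f x.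

(** The extension property of the open cone over P: a point with level [u] > 0
    has a coordinate [y] in P, the apex has [u = 0].  Hence [y] is uniformly
    continuous only where [u] is bounded away from 0. *)
Definition cone_extensor (P : Type) (dP : P -> P -> R) : Prop :=
  forall (T : Type) (d : T -> T -> R) (b : T -> R) (u : T -> R) (y : T -> P),
    pseudometric d -> (forall x, 0 <= b x) ->
    unif_cont_on d rdist setT b ->
    (forall x, b x = 0 -> 0 <= u x <= 1) ->
    unif_cont_on d rdist [set x | b x = 0] u ->
    (forall eps, 0 < eps -> unif_cont_on d dP [set x | b x = 0 /\ eps <= u x] y) ->
    exists U : T -> R, exists eta : T -> P,
    [/\ forall x, 0 <= U x <= 1,
        unif_cont_on d rdist setT U,
        forall eps, 0 < eps -> unif_cont_on d dP [set x | eps <= U x] eta,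
        forall x, b x = 0 -> U x = u x
      & forall x, b x = 0 -> 0 < u x -> eta x = y x].

Section Extension.
Variables (P : Type) (dP : P -> P -> R).
Hypothesis dPP : pseudometric dP.
Hypothesis dP1 : forall x y, dP x y <= 1.

Lemma dist_lip x y s : `|dP x s - dP y s| <= dP x y.
Proof.
case: dPP => _ _ ds dt; apply: ler_dist; first by have := dt x y s; lra.
by have := dt y x s; rewrite (ds y x); lra.
Qed.

(** The Kuratowski coordinates of [f] extend to T; with [b] as collar coordinate
    the extension stays in the collar, because [b] vanishes on the zero set only,
    where the functions are in the image of P. *)
Lemma retract_absolute_extensor r :
  collar_retraction dP setT r -> absolute_extensor dP.
Proof.
case: (dPP) => dp0 dpxx dps dpt [rK rc] T d b f dd b0 bc fc.
pose F s x := dP (f x) s.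
have [|eps eps0|rho [rhoP rhoc FL]] := modulus_pseudometric (B := [set x | b x = 0]) (F := F) dd.
- by move=> s x _; rewrite dp0 dP1.
- have [del del0 H] := fc _ eps0; exists del => // s x y bx b_y xy.
  by apply: le_lt_trans (dist_lip _ _ _) _; apply: H.
have [|G [G01 GF Gl]] := mcshane _ rhoP FL; first by move=> s x _; rewrite dp0 dP1.
pose w x s := if s is Some p then G p x else b x.
have wf x : b x = 0 -> w x = kuratowski dP (f x).
  by move=> bx; apply/funext => -[p|] //=; rewrite GF.
exists (fun x => r (w x)); last by move=> x bx; rewrite wf.
move=> eps eps0; have [e e0 re] := rc _ eps0.
have [e1 e10 H1] := bc _ e0; have [e2 e20 H2] := rhoc _ e0.
exists (Num.min e1 e2); first by rewrite lt_min e10.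
move=> x y _ _; rewrite lt_min => /andP[xy1 xy2]; apply: re => //.
- by move=> bx; exists (f x); rewrite wf.
- by move=> bx; exists (f y); rewrite wf.
- case=> [p|] /=; first by apply: le_lt_trans (Gl _ _ _) (H2 _ _ xy2).
  exact: H1.
Qed.

Lemma scaled_dist_lt (a a' d1 d2 e : R) : 0 <= a <= 1 -> 0 <= a' <= 1 -> 0 <= d1 <= 1 ->
  0 <= d2 <= 1 -> `|a - a'| < e -> `|d1 - d2| < e -> `|a * d1 - a' * d2| < 2 * e.
Proof.
move=> /andP[? ?] /andP[? ?] /andP[? ?] /andP[? ?] h1 h2.
rewrite (_ : a * d1 - a' * d2 = (a - a') * d1 + a' * (d1 - d2)); last by ring.
apply: le_lt_trans (ler_normD _ _) _; rewrite !normrM mulr_natl mulr2n.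
rewrite (ger0_norm (x := d1)) // (ger0_norm (x := a')) //.
have : `|a - a'| * d1 <= `|a - a'| by rewrite ler_piMr.
have : a' * `|d1 - d2| <= `|d1 - d2| by rewrite ler_piMl.
by lra.
Qed.

Lemma small_prod_dist (a a' d1 d2 e : R) : 0 <= a <= 1 -> 0 <= a' <= 1 ->
  0 <= d1 <= 1 -> 0 <= d2 <= 1 -> (a < e / 4) || (a' < e / 4) ->
  `|a - a'| < e / 4 -> `|a * d1 - a' * d2| < e.
Proof.
move=> /andP[? ?] /andP[? ?] /andP[? ?] /andP[? ?] h /lt_dist[? ?].
have [? ?] : a < e / 2 /\ a' < e / 2 by case/orP: h => ?; split; lra.
have : 0 <= a * d1 <= a by rewrite mulr_ge0 //= ler_piMr.
have : 0 <= a' * d2 <= a' by rewrite mulr_ge0 //= ler_piMr.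
by move=> /andP[? ?] /andP[? ?]; rewrite ltr_norml; apply/andP; split; lra.
Qed.

Lemma quotient_dist (a a' v v' e g : R) : 0 < g -> 0 < e -> 0 <= a <= 1 ->
  g <= v <= 1 -> g <= v' <= 1 -> `|a - a'| < e * g ^+ 2 / 2 ->
  `|v - v'| < e * g ^+ 2 / 2 -> `|a / v - a' / v'| < e.
Proof.
move=> g0 e0 /andP[a0 a1] /andP[gv v1] /andP[gv' v1'] /lt_dist[? ?] /lt_dist[? ?].
have vp : 0 < v by lra.
have vp' : 0 < v' by lra.
have vv : g ^+ 2 <= v * v' by rewrite expr2; apply: ler_pM => //; lra.
have vvd : e * g ^+ 2 <= e * (v * v') by rewrite ler_pM2l.
rewrite (_ : _ - _ = (a * (v' - v) + v * (a - a')) / (v * v')); last first.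
  by field; rewrite !gt_eqF.
rewrite normrM normfV (gtr0_norm (mulr_gt0 vp vp')) ltr_pdivrMr ?mulr_gt0 //.
by rewrite ltr_norml; apply/andP; split; nra.
Qed.

Lemma quotient_near (a v u dd r e K : R) : 0 < e -> 0 < K -> K * e = e + 2 ->
  0 < v -> 0 <= dd <= 1 -> r < v / K ->
  `|a - u * dd| <= r -> `|v - u| <= r -> `|a / v - dd| < e.
Proof.
move=> e0 K0 Ke vp /andP[d0 d1]; rewrite ltr_pdivlMr // => rK.
rewrite !ler_norml => /andP[? ?] /andP[? ?].
rewrite (_ : _ - _ = (a - v * dd) / v); last by field; rewrite gt_eqF.
rewrite normrM normfV (gtr0_norm vp) ltr_pdivrMr //.
have rv : 2 * r < e * v.
  have : r * (K * e) < v * e by rewrite mulrA ltr_pM2r.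
  have : 0 <= r by lra.
  by rewrite Ke; nra.
by rewrite ltr_norml; apply/andP; split; nra.
Qed.

(** The functions [u * d(y,.)] are uniformly continuous up to the apex, so they
    extend, and their quotient by the extended level [v] is the candidate for the
    coordinate.  It lies in the domain of the retraction where the distance to
    the zero set is small in comparison with [v]; subtracting [K] times that
    distance from [v] gives a level which is positive only there. *)
Lemma retract_cone_extensor e0 r : 0 < e0 ->
  collar_retraction dP (near_kuratowski dP e0) r -> cone_extensor dP.
Proof.
move=> e0p [rK rc] T d b u y dd b0 bc u01 uc yc.
case: (dPP) => dp0 dpxx dps dpt.
pose B := [set x | b x = 0].
(* The index [None] carries the level itself. *)
pose F (s : option P) x := if s is Some p then u x * dP (y x) p else u x.
have F01 s x : B x -> 0 <= F s x <= 1.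
  move=> /u01 /[dup] /andP[u0 u1] uu; case: s => [p|] //=.
  by rewrite mulr_ge0 // mulr_ile1.
have Fuc eps : 0 < eps -> exists2 del, 0 < del &
    forall s x y, B x -> B y -> d x y < del -> `|F s x - F s y| < eps.
  move=> eps0; have e40 : 0 < eps / 4 by lra.
  have [d1 d10 H1] := uc _ e40; have [d2 d20 H2] := yc _ e40 _ e40.
  exists (Num.min d1 d2); first by rewrite lt_min d10.
  move=> s x x' Bx Bx'; rewrite lt_min => /andP[xx1 xx2].
  have := H1 _ _ Bx Bx' xx1; rewrite /rdist => ux.
  case: s => [p|] /=; last by lra.
  have [ue|ue] := leP (eps / 4) (u x); first have [ue'|ue'] := leP (eps / 4) (u x').
  - have h : `|u x * dP (y x) p - u x' * dP (y x') p| < 2 * (eps / 4).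
      apply: scaled_dist_lt; rewrite ?dp0 ?dP1 ?u01 //.
      by apply: le_lt_trans (dist_lip _ _ _) _; apply: H2.
    by lra.
  - by apply: (small_prod_dist (e := eps)); rewrite ?u01 ?dp0 ?dP1 ?ue ?ue' ?orbT.
  - by apply: (small_prod_dist (e := eps)); rewrite ?u01 ?dp0 ?dP1 ?ue ?ue' ?orbT.
have [rho [rhoP rhoc FL]] := modulus_pseudometric dd F01 Fuc.
have [G [G01 GF Gl]] := mcshane F01 rhoP FL.
have [D [D0 DB Dl Da]] := dist_fun B rhoP.
pose v := G None.
(* [K * e0 > 2] keeps the quotient within [e0] of the Kuratowski image, since the
   errors in its numerator and its denominator are both below [v / K]. *)
pose K := 1 + 2 / e0.
have Ke0 : K * e0 = e0 + 2 by rewrite /K mulrDl mul1r divfK // gt_eqF.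
have K1 : 1 <= K by rewrite lerDl divr_ge0 // ltW.
have Kp : 0 < K by lra.
have K0 : 0 <= K by lra.
have KDb x : 0 <= K * (D x + b x) by apply: mulr_ge0 => //; exact: addr_ge0.
have KD x : 0 <= K * D x by exact: mulr_ge0.
have Kb x : 0 <= K * b x by exact: mulr_ge0.
have v01 x : 0 <= v x <= 1 by exact: G01.
pose U x := Num.max 0 (v x - K * (D x + b x)).
pose w x s := if s is Some p then G (Some p) x / v x else b x.
have U01 x : 0 <= U x <= 1.
  rewrite /U le_max lexx /= ge_max ler01 /=.
  by have /andP[? ?] := v01 x; have := KDb x; lra.
have Uv x : U x <= v x.
  by rewrite /U ge_max; have /andP[-> _ /=] := v01 x; rewrite gerBl.
have Upos x : 0 < U x -> near_kuratowski dP e0 (w x).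
  rewrite /U lt_max ltxx /= => vx; have /andP[v0 v1] := v01 x.
  have bx := b0 x; have Dx := D0 x.
  have KDx := KD x; have Kbx := Kb x.
  have vp : 0 < v x by have := KDb x; lra.
  have bK : b x < v x / K by rewrite ltr_pdivlMr //; nra.
  have DK : D x < v x / K by rewrite ltr_pdivlMr //; nra.
  have vK : v x / K < v x / 2 * e0.
    rewrite ltr_pdivrMr //.
    rewrite (_ : v x / 2 * e0 * K = v x / 2 * (K * e0)); last by ring.
    by rewrite Ke0; nra.
  have vK1 : v x / K <= v x by rewrite ler_pdivrMr //; nra.
  have [|c Bc xc] := Da x _ DK; first by lra.
  have uvc : u c = v c by rewrite /v GF.
  exists (y c) => -[p|] /=; last first.
    by rewrite subr0 ger0_norm //; nra.
  apply: (quotient_near (u := v c) (r := rho x c) e0p Kp Ke0 vp) => //.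
  - by rewrite dp0 dP1.
  - by have := Gl (Some p) x c; rewrite (GF _ c) //= uvc.
  - exact: Gl.
have wB x : b x = 0 -> 0 < v x -> w x = kuratowski dP (y x).
  move=> bx vx; apply/funext => -[p|] //=; rewrite GF //= /v GF //= mulrC mulKf //.
  by move: vx; rewrite /v GF //= => /gt_eqF ->.
exists U, (fun x => r (w x)); split => //.
- move=> eps eps0; have e30 : 0 < eps / (3 * K) by rewrite divr_gt0 //; lra.
  have [d1 d10 H1] := bc _ e30; have [d2 d20 H2] := rhoc _ e30.
  exists (Num.min d1 d2); first by rewrite lt_min d10.
  move=> x x' _ _; rewrite lt_min => /andP[xx1 xx2].
  have r3 := H2 _ _ xx2.
  have eK : eps / (3 * K) * K = eps / 3 by field; rewrite gt_eqF //; lra.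
  have := H1 _ _ I I xx1; rewrite /rdist => /lt_dist[b1 b2].
  have := le_lt_trans (Gl None x x') r3; rewrite -/(v x) -/(v x') => /lt_dist[v1 v2].
  have := le_lt_trans (Dl x x') r3 => /lt_dist[D1 D2].
  have e3e : eps / (3 * K) <= eps / 3 by nra.
  set e3 := eps / (3 * K) in b1 b2 v1 v2 D1 D2 eK e3e *.
  have h1 : K * (D x - D x') < eps / 3 by nra.
  have h2 : K * (D x' - D x) < eps / 3 by nra.
  have h3 : K * (b x - b x') < eps / 3 by nra.
  have h4 : K * (b x' - b x) < eps / 3 by nra.
  apply: dist_max_lt; first by rewrite subrr normr0.
  by rewrite ltr_norml; apply/andP; split; lra.
- move=> eps eps0 e e_0; have [del del0 H] := rc _ e_0.
  have m0 : 0 < del * eps ^+ 2 / 2 by rewrite divr_gt0 // mulr_gt0 // exprn_gt0.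
  have [d1 d10 H1] := bc _ del0; have [d2 d20 H2] := rhoc _ m0.
  exists (Num.min d1 d2); first by rewrite lt_min d10.
  move=> x x' /= Ux Ux'; rewrite lt_min => /andP[xx1 xx2].
  have up : 0 < U x by lra.
  have up' : 0 < U x' by lra.
  have vx : eps <= v x by rewrite (le_trans Ux).
  have vx' : eps <= v x' by rewrite (le_trans Ux').
  have vp : 0 < v x by lra.
  have vp' : 0 < v x' by lra.
  apply: H; [| |exact: Upos|exact: Upos|].
  + by move=> bx; exists (y x); rewrite wB.
  + by move=> bx; exists (y x'); rewrite wB.
  + case=> [p|] /=; last exact: H1.
    have r3 := H2 _ _ xx2.
    have /andP[_ v1x] := v01 x; have /andP[_ v1x'] := v01 x'.
    apply: (quotient_dist eps0 del0); rewrite ?G01 ?vx ?vx' //.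
      exact: le_lt_trans (Gl _ _ _) r3.
    exact: le_lt_trans (Gl _ _ _) r3.
- move=> x bx; rewrite /U bx DB // !addr0 mulr0 subr0 /v GF //= maxEle.
  by have /andP[->] := u01 _ bx.
- by move=> x bx ux; rewrite wB // /v GF.
Qed.

End Extension.
End Cone.

(** * Equiconnecting maps *)

Section Connector.
Variable R : realType.
Variables (V : Type) (d : V -> V -> R).
Hypothesis dP : pseudometric d.
Hypothesis dsep : forall x y, d x y = 0 -> x = y.

(** An equiconnecting map: [G a b] is a path from [a] to [b], constant when
    [a = b], and depending uniformly on its ends. *)
Definition connector (G : V -> V -> R -> V) : Prop :=
  [/\ forall a b t, t <= 0 -> G a b t = a, forall a b t, 1 <= t -> G a b t = b,
      forall a t, G a a t = a
    & forall eps, 0 < eps -> exists2 del, 0 < del & forall a b t a' b' t',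
        d a a' < del -> d b b' < del -> `|t - t'| < del ->
        d (G a b t) (G a' b' t') < eps].

(** Extend the map that is [a] for [t <= 0], [b] for [t >= 1], and the common
    value when [a = b]. *)
Lemma ex_connector : absolute_extensor d -> exists G, connector G.
Proof.
case: (dP) => d0 dxx ds dt dE.
pose T := (V * V * R)%type.
pose dT (x y : T) := d x.1.1 y.1.1 + d x.1.2 y.1.2 + `|x.2 - y.2|.
have dTP : pseudometric dT.
  rewrite /dT; split=> [x y|x|x y|x y z].
  - by rewrite !addr_ge0.
  - by rewrite !dxx subrr normr0 !addr0.
  - by rewrite (ds x.1.1) (ds x.1.2) distrC.
  - have := dt x.1.1 y.1.1 z.1.1; have := dt x.1.2 y.1.2 z.1.2.
    by have := ler_distD y.2 x.2 z.2; lra.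
pose b (x : T) := Num.min (d x.1.1 x.1.2) (Num.max 0 (Num.min x.2 (1 - x.2))).
pose f (x : T) := if 1 <= x.2 then x.1.2 else x.1.1.
have bE x : b x = 0 -> x.1.1 = x.1.2 \/ x.2 <= 0 \/ 1 <= x.2.
  rewrite /b !minEle maxEle; do !case: ifPn; rewrite -?ltNge; move=> *;
    (try by right; left; lra); (try by right; right; lra); left; apply: dsep; lra.
have bE' x : x.1.1 = x.1.2 \/ x.2 <= 0 \/ 1 <= x.2 -> b x = 0.
  have := d0 x.1.1 x.1.2; rewrite /b => + [->|H].
    by rewrite dxx => _; apply/min_idPl; rewrite le_max lexx.
  move=> dx; rewrite (_ : Num.max _ _ = 0); first exact/min_idPr.
  apply/max_idPl; rewrite ge_min; case: H => [->//|?].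
  by apply/orP; right; lra.
have [|||g gc gE] := dE T dT b f dTP.
- by move=> x; rewrite /b le_min d0 le_max lexx.
- move=> e e0; exists e => // x y _ _; rewrite /dT => xy.
  have n1 := d0 x.1.1 y.1.1; have n2 := d0 x.1.2 y.1.2; have n3 := normr_ge0 (x.2 - y.2).
  apply: dist_min_lt; last apply: dist_max_lt; last apply: dist_min_lt.
  + have h1 := dt x.1.1 y.1.1 x.1.2; have h2 := dt y.1.1 y.1.2 x.1.2.
    have h3 := dt y.1.1 x.1.1 y.1.2; have h4 := dt x.1.1 x.1.2 y.1.2.
    rewrite (ds y.1.2 x.1.2) in h2; rewrite (ds y.1.1 x.1.1) in h3.
    by rewrite ltr_norml; apply/andP; split; lra.
  + by rewrite subrr normr0; lra.
  + by lra.
  + by rewrite opprB addrC addrA subrK distrC; lra.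
- move=> e e0; exists (Num.min e 1); first by rewrite lt_min e0 ltr01.
  move=> x y /= /bE bx /bE b_y; rewrite lt_min /dT => /andP[xy xy1].
  have := d0 x.1.1 y.1.1; have := d0 x.1.2 y.1.2; have n0 := normr_ge0 (x.2 - y.2).
  have : `|x.2 - y.2| < 1 by have := d0 x.1.1 y.1.1; have := d0 x.1.2 y.1.2; lra.
  move=> /lt_dist[t1 t2] h1 h2; rewrite /f.
  case: ifPn; case: ifPn; rewrite -?ltNge => y1 x1; try by lra.
  + case: b_y => [->|[?|?]]; [|by lra|by lra].
    by lra.
  + case: bx => [->|[?|?]]; [|by lra|by lra].
    by lra.
exists (fun a b t => g (a, b, t)); split.
- move=> a b' t t0; rewrite gE /f /=; last by apply: bE'; right; left.
  by case: ifPn => // t1; exfalso; lra.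
- by move=> a b' t t1; rewrite gE /f /= ?t1 //; apply: bE'; right; right.
- by move=> a t; rewrite gE /f /= ?if_same //; apply: bE'; left.
- move=> e e0; have [del del0 H] := gc _ e0.
  exists (del / 3); first by lra.
  move=> a b1 t a' b1' t' ? ? ?; apply: H => //; rewrite /dT /=; lra.
Qed.

End Connector.

(** * Mapping cylinders *)

Section Cylinder.
Variable R : realType.

(** A map which is uniformly continuous where [l] is bounded away from 0 is
    uniformly continuous if it approaches a uniformly continuous map as [l] tends
    to 0.  This is how maps depending on a coordinate that exists only at positive
    levels are seen to be uniformly continuous. *)
Lemma unif_cont_squash (T M : Type) (d : T -> T -> R) (dM : M -> M -> R)
    (S : set T) (l : T -> R) (w w0 : T -> M) :
  pseudometric dM -> unif_cont_on d rdist S l -> unif_cont_on d dM S w0 ->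
  (forall e, 0 < e -> unif_cont_on d dM [set x | S x /\ e <= l x] w) ->
  (forall e, 0 < e -> exists2 del, 0 < del &
     forall x, S x -> l x < del -> dM (w x) (w0 x) < e) ->
  unif_cont_on d dM S w.
Proof.
move=> [_ _ ds dt] lc w0c wc wsmall e e0.
have e30 : 0 < e / 3 by lra.
have [a a0 Ha] := wsmall _ e30; have a20 : 0 < a / 2 by lra.
have [d1 d10 H1] := lc _ a20; have [d2 d20 H2] := w0c _ e30.
have [d3 d30 H3] := wc _ a20 _ e0.
exists (Num.min d1 (Num.min d2 d3)); first by rewrite !lt_min d10 d20.
move=> x y Sx Sy; rewrite !lt_min => /and3P[xy1 xy2 xy3].
have /lt_dist[l1 l2] := H1 _ _ Sx Sy xy1.
have small : l x < a -> l y < a -> dM (w x) (w y) < e.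
  move=> /(Ha _ Sx) wx /(Ha _ Sy) wy; have := H2 _ _ Sx Sy xy2.
  have := dt (w x) (w0 x) (w y); have := dt (w0 x) (w0 y) (w y).
  by rewrite (ds (w0 y)); lra.
have [lx|lx] := leP (a / 2) (l x); last by apply: small; lra.
have [ly|ly] := leP (a / 2) (l y); last by apply: small; lra.
exact: H3.
Qed.

(** The mapping cylinder of [g] as a set.  A level is 0 on the base [V] and 1
    on the far end; the level, the retraction and the coordinate in [P] (defined
    at positive levels) determine a point. *)
Record cylinder (V P V' : Type) (g : P -> V) := Cylinder {
  cyl_base : V -> V';
  cyl_seg : P -> R -> V';
  cyl_retr : V' -> V;
  cyl_lev : V' -> R;
  cyl_pt : V' -> option P;
  cyl_retr_base : forall v, cyl_retr (cyl_base v) = v;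
  cyl_lev_base : forall v, cyl_lev (cyl_base v) = 0;
  cyl_retr_seg : forall x h, 0 < h <= 1 -> cyl_retr (cyl_seg x h) = g x;
  cyl_lev_seg : forall x h, 0 < h <= 1 -> cyl_lev (cyl_seg x h) = h;
  cyl_pt_seg : forall x h, 0 < h <= 1 -> cyl_pt (cyl_seg x h) = Some x;
  cyl_cases : forall a, a = cyl_base (cyl_retr a) \/
    exists2 x, 0 < cyl_lev a <= 1 & a = cyl_seg x (cyl_lev a) }.

(** Points at level 0 have no coordinate in P; the value 1 makes this a bounded
    pseudometric, and the factor that multiplies it in [cyl_dist] vanishes when
    one level is 0. *)
Definition option_dist (P : Type) (dP : P -> P -> R) (a b : option P) : R :=
  match a, b with Some x, Some y => dP x y | None, None => 0 | _, _ => 1 end.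

Lemma option_dist_pm (P : Type) (dP : P -> P -> R) :
  pseudometric dP -> (forall x y, dP x y <= 1) ->
  pseudometric (option_dist dP) /\ forall a b, option_dist dP a b <= 1.
Proof.
move=> [d0 dxx ds dt] d1; split; last by case=> [x|] [y|] //=; rewrite ?ler01.
split.
- by case=> [x|] [y|] //=; rewrite ?ler01.
- by case=> [x|] /=.
- by case=> [x|] [y|] //=.
- case=> [x|] [y|] [z|] //=; rewrite ?addr0 ?add0r ?lerDl ?lerDr //; try lra.
  by have := d1 x z; lra.
Qed.

Section Dist.
Variables (V P V' : Type) (g : P -> V) (C : cylinder V' g).
Variables (dV : V -> V -> R) (dP : P -> P -> R).
Hypothesis dVP : pseudometric dV.
Hypothesis dPP : pseudometric dP.
Hypothesis dP1 : forall x y, dP x y <= 1.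

Definition cyl_dist (a b : V') : R :=
  dV (cyl_retr C a) (cyl_retr C b) + `|cyl_lev C a - cyl_lev C b| +
  Num.min (cyl_lev C a) (cyl_lev C b) * option_dist dP (cyl_pt C a) (cyl_pt C b).

Lemma cyl_lev01 a : 0 <= cyl_lev C a <= 1.
Proof.
case: (cyl_cases C a) => [->|[x /andP[a0 a1] _]]; last by rewrite ltW.
by rewrite cyl_lev_base lexx ler01.
Qed.

(** If [l2] lies below both other levels, the descent to [l2] costs twice the
    difference, which pays for [d13 <= 1]. *)
Lemma cone_triangle (l1 l2 l3 d12 d23 d13 : R) : 0 <= l1 -> 0 <= l2 -> 0 <= l3 ->
  0 <= d12 -> 0 <= d23 -> d13 <= 1 -> d13 <= d12 + d23 ->
  `|l1 - l3| + Num.min l1 l3 * d13 <=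
  (`|l1 - l2| + Num.min l1 l2 * d12) + (`|l2 - l3| + Num.min l2 l3 * d23).
Proof.
move=> l10 l20 l30 d120 d230 d131 dt.
have t : `|l1 - l3| <= `|l1 - l2| + `|l2 - l3| by exact: ler_distD.
have [m0 m1 m3] : [/\ 0 <= Num.min l1 l3, Num.min l1 l3 <= l1 & Num.min l1 l3 <= l3].
  by rewrite le_min l10 l30 !ge_min !lexx orbT.
have e13 : `|l1 - l3| = l1 + l3 - 2 * Num.min l1 l3.
  by rewrite minEle; case: ifPn; rewrite -?ltNge => ?; [rewrite ler0_norm|rewrite gtr0_norm]; lra.
move: (Num.min l1 l3) m0 m1 m3 e13 => m m0 m1 m3 e13.
have [ml|lm] := leP m l2.
  have h1 : m * d12 <= Num.min l1 l2 * d12 by apply: ler_wpM2r => //; rewrite le_min m1.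
  have h2 : m * d23 <= Num.min l2 l3 * d23 by apply: ler_wpM2r => //; rewrite le_min ml.
  have h3 : m * d13 <= m * (d12 + d23) by exact: ler_wpM2l.
  by rewrite mulrDr in h3; lra.
have -> : Num.min l1 l2 = l2 by apply/min_idPr; lra.
have -> : Num.min l2 l3 = l2 by apply/min_idPl; lra.
rewrite e13 (ger0_norm (x := l1 - l2)); last by lra.
rewrite (ler0_norm (x := l2 - l3)); last by lra.
have h1 : l2 * d13 <= l2 * (d12 + d23) by exact: ler_wpM2l.
have h2 : (m - l2) * d13 <= (m - l2) by rewrite ler_piMr //; lra.
by rewrite mulrDr in h1; rewrite mulrBl in h2; lra.
Qed.

Lemma cyl_dist_pm : pseudometric cyl_dist.
Proof.
have [[ o0 oxx os ot] o1] := option_dist_pm dPP dP1.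
case: dVP => d0 dxx ds dt; rewrite /cyl_dist; split=> [a b|a|a b|a b c].
- have /andP[? _] := cyl_lev01 a; have /andP[? _] := cyl_lev01 b.
  by rewrite !addr_ge0 // mulr_ge0 // le_min; apply/andP.
- by rewrite dxx subrr normr0 oxx mulr0 !addr0.
- by rewrite ds distrC minC os.
- have /andP[a0 _] := cyl_lev01 a; have /andP[b0 _] := cyl_lev01 b.
  have /andP[c0 _] := cyl_lev01 c.
  have := dt (cyl_retr C a) (cyl_retr C b) (cyl_retr C c).
  have := cone_triangle a0 b0 c0 (o0 (cyl_pt C a) (cyl_pt C b))
    (o0 (cyl_pt C b) (cyl_pt C c)) (o1 (cyl_pt C a) (cyl_pt C c))
    (ot (cyl_pt C a) (cyl_pt C b) (cyl_pt C c)).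
  by lra.
Qed.

Lemma cyl_retr_lip a b : dV (cyl_retr C a) (cyl_retr C b) <= cyl_dist a b.
Proof.
have [[ o0 _ _ _] _] := option_dist_pm dPP dP1.
rewrite /cyl_dist -addrA lerDl addr_ge0 // mulr_ge0 // le_min.
by have /andP[-> _] := cyl_lev01 a; have /andP[-> _] := cyl_lev01 b.
Qed.

Lemma cyl_lev_lip a b : `|cyl_lev C a - cyl_lev C b| <= cyl_dist a b.
Proof.
have [[ o0 _ _ _] _] := option_dist_pm dPP dP1; have [d0 _ _ _] := dVP.
rewrite /cyl_dist addrAC lerDr addr_ge0 // mulr_ge0 // le_min.
by have /andP[-> _] := cyl_lev01 a; have /andP[-> _] := cyl_lev01 b.
Qed.

Lemma cyl_pt_lip e a b : e <= cyl_lev C a -> e <= cyl_lev C b ->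
  e * option_dist dP (cyl_pt C a) (cyl_pt C b) <= cyl_dist a b.
Proof.
move=> ea eb; have [[ o0 _ _ _] _] := option_dist_pm dPP dP1; have [d0 _ _ _] := dVP.
rewrite /cyl_dist -[X in X <= _]add0r lerD ?addr_ge0 // ler_wpM2r //.
by rewrite le_min ea.
Qed.

Lemma cyl_dist_sep : (forall x y, dV x y = 0 -> x = y) ->
  (forall x y, dP x y = 0 -> x = y) ->
  forall a b, cyl_dist a b = 0 -> a = b.
Proof.
move=> dVs dPs a b ab0; have [d0 _ _ _] := dVP; have [dp0 _ _ _] := dPP.
have rab : cyl_retr C a = cyl_retr C b.
  by apply: dVs; apply/eqP; rewrite eq_le d0 andbT -ab0 cyl_retr_lip.
have lab : cyl_lev C a = cyl_lev C b.
  by apply/eqP; rewrite -subr_eq0 -normr_le0 -ab0 cyl_lev_lip.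
case: (cyl_cases C a) (cyl_cases C b) => [ea|[x xa ea]] [eb|[y yb eb]].
- by rewrite ea eb rab.
- by move: yb; rewrite -lab ea cyl_lev_base ltxx.
- by move: xa; rewrite lab eb cyl_lev_base ltxx.
- have ap : cyl_pt C a = Some x by rewrite ea cyl_pt_seg.
  have bp : cyl_pt C b = Some y by rewrite eb cyl_pt_seg.
  have := @cyl_pt_lip (cyl_lev C b) a b; rewrite lab lexx ap bp ab0 /= => /(_ isT isT).
  case/andP: yb => yb _; rewrite pmulr_rle0 // => h.
  rewrite ea eb lab (dPs x y) //; apply/eqP; rewrite eq_le dp0 andbT.
  exact: h.
Qed.

(** Where one of the levels is small, so is the last term of [cyl_dist], whatever
    the coordinates are; elsewhere the coordinate is uniformly continuous. *)
Lemma cyl_unif_cont (T : Type) (d : T -> T -> R) (S : set T) (w : T -> V') :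
  unif_cont_on d dV S (cyl_retr C \o w) ->
  unif_cont_on d rdist S (cyl_lev C \o w) ->
  (forall e, 0 < e -> unif_cont_on d (option_dist dP)
     [set x | S x /\ e <= cyl_lev C (w x)] (cyl_pt C \o w)) ->
  unif_cont_on d cyl_dist S w.
Proof.
have [[ o0 _ _ _] o1] := option_dist_pm dPP dP1.
move=> rc lc pc e e0; have e30 : 0 < e / 3 by lra.
have [d1 d10 H1] := rc _ e30; have [d2 d20 H2] := lc _ e30.
have [d3 d30 H3] := pc _ e30 _ e30.
exists (Num.min d1 (Num.min d2 d3)); first by rewrite !lt_min d10 d20.
move=> x y Sx Sy; rewrite !lt_min => /and3P[xy1 xy2 xy3].
have := H1 _ _ Sx Sy xy1; have := H2 _ _ Sx Sy xy2; rewrite /cyl_dist /rdist /=.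
have := o0 (cyl_pt C (w x)) (cyl_pt C (w y)); have := o1 (cyl_pt C (w x)) (cyl_pt C (w y)).
set o := option_dist _ _ _; set lx := cyl_lev C (w x); set ly := cyl_lev C (w y).
have /andP[x0 x1] : 0 <= lx <= 1 by exact: cyl_lev01.
have /andP[y0 y1] : 0 <= ly <= 1 by exact: cyl_lev01.
move=> oo1 oo0 h2 h1; suff : Num.min lx ly * o < e / 3 by lra.
have m0 : 0 <= Num.min lx ly by rewrite le_min x0.
have mo : Num.min lx ly * o <= Num.min lx ly by rewrite ler_piMr.
have [lxe|lxe] := leP (e / 3) lx; last by rewrite (le_lt_trans mo) // gt_min lxe.
have [lye|lye] := leP (e / 3) ly; last by rewrite (le_lt_trans mo) // gt_min lye orbT.
apply: (@le_lt_trans _ _ o); last exact: H3.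
by rewrite ler_piMl // ge_min x1.
Qed.

End Dist.

Section Lift.
Variables (V P V' : Type) (g : P -> V) (C : cylinder V' g).
Variables (dV : V -> V -> R) (dP : P -> P -> R).
Hypothesis dVP : pseudometric dV.
Hypothesis dPP : pseudometric dP.
Hypothesis dP1 : forall x y, dP x y <= 1.
Hypothesis dVsep : forall x y, dV x y = 0 -> x = y.
Hypothesis gc : unif_cont_on dP dV setT g.
Hypothesis Vae : absolute_extensor dV.
Hypothesis Pce : inhabited P -> cone_extensor dP.
Local Notation D := (cyl_dist C dV dP).

(** The controlled lifting of a map from the base to the mapping cylinder.  Let
    [U], [eta] extend the level and the coordinate of [f], and let [e] be the
    distance from [c] to [g \o eta].  Lower the level [U] by a multiple of [e] to
    get [U1]: where it is positive, [e] is small in comparison with [U].  So moving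
    [c] towards [g \o eta] for the time [min 1 (2 * (U1 / U))] is a small and
    uniformly continuous change [c'], even as [U] tends to 0.  The move is
    complete where [U1 / U >= 1/2], in particular wherever the still lower
    level [U2 = 2 * U1 - U] is positive, so that [c'], [U2], [eta] define a map
    into the cylinder.  On the zero set nothing changes. *)
Lemma cyl_lift (T : Type) (d : T -> T -> R) (b : T -> R) (f : T -> V') (c : T -> V)
    (ep dl : R) :
  pseudometric d -> (forall x, 0 <= b x) -> unif_cont_on d rdist setT b ->
  unif_cont_on d D [set x | b x = 0] f ->
  unif_cont_on d dV setT c -> (forall x, b x = 0 -> c x = cyl_retr C (f x)) ->
  0 < ep -> 0 < dl ->
  exists h : T -> V',
  [/\ unif_cont_on d D setT h, forall x, b x = 0 -> h x = f x,
      forall x, dV (cyl_retr C (h x)) (c x) < ep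
    & forall x, dl <= b x -> h x = cyl_base C (c x)].
Proof.
move=> dd b0 bc fc cc cf ep0 dl0.
case: (dVP) => dv0 dvxx dvs dvt; case: (dPP) => dp0 _ dps _.
have [[ o0 oxx os ot] o1] := option_dist_pm dPP dP1.
have [Pi|Pe] := pselect (inhabited P); last first.
  exists (fun x => cyl_base C (c x)); split => //.
  - apply: cyl_unif_cont => //.
    + by move=> e /cc[del del0 H]; exists del => // x y; rewrite /= !cyl_retr_base; exact: H.
    + move=> e e0; exists 1 => // x y _ _ _ /=.
      by rewrite /rdist !cyl_lev_base subrr normr0.
    + by move=> e e0 e' e'0; exists 1 => // x y [_]; rewrite cyl_lev_base leNgt e0.
  - move=> x bx; rewrite cf //; case: (cyl_cases C (f x)) => // -[p] _ _.
    by case: Pe.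
  - by move=> x; rewrite cyl_retr_base dvxx.
have [p0] := Pi.
pose u x := cyl_lev C (f x).
pose y x := odflt p0 (cyl_pt C (f x)).
have ptf x : 0 < u x -> cyl_pt C (f x) = Some (y x).
  rewrite /u /y; case: (cyl_cases C (f x)) => [->|[p lp ->]].
    by rewrite cyl_lev_base ltxx.
  by rewrite cyl_pt_seg.
have u01 x : 0 <= u x <= 1 by exact: cyl_lev01.
have uc : unif_cont_on d rdist [set x | b x = 0] u.
  move=> e /fc[del del0 H]; exists del => // x x' bx bx' /(H _ _ bx bx').
  by apply: le_lt_trans; exact: cyl_lev_lip.
have yc e : 0 < e -> unif_cont_on d dP [set x | b x = 0 /\ e <= u x] y.
  move=> e0 e' e'0; have [|del del0 H] := fc (e * e'); first exact: mulr_gt0.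
  exists del => // x x' [bx ex] [bx' ex'] /(H _ _ bx bx') h.
  have := le_lt_trans (cyl_pt_lip dVP dPP dP1 ex ex') h.
  by rewrite !ptf ?(lt_le_trans e0) // ltr_pM2l.
have [|U [eta [U01 Uc etac Uu etay]]] := Pce Pi dd b0 bc _ uc yc.
  by move=> x _.
have [G [G0 G1 Gd Gc]] := ex_connector dVP dVsep Vae.
(* The path stays near its start when its ends are close, or at small times. *)
have Gnear e : 0 < e -> exists2 del, 0 < del & forall a a' t,
    (dV a a' < del \/ t < del) -> dV (G a a' t) a < e.
  move=> e0; have [del del0 H] := Gc _ e0; exists del => // a a' t [aa|tt].
    by rewrite -[X in dV _ X](Gd a t); apply: H; rewrite ?dvxx ?subrr ?normr0 // dvs.
  have [t0|t0] := leP t 0; first by rewrite G0 ?dvxx.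
  rewrite -[X in dV _ X](G0 a a' 0) //; apply: H; rewrite ?dvxx //.
  by rewrite subr0 gtr0_norm.
have [k k0 Hk] := Gnear _ ep0.
pose e x := dV (c x) (g (eta x)).
(* The term in [b] makes [U1] vanish where [dl <= b]. *)
pose U1 x := Num.max 0 (U x - (k^-1 * e x + dl^-1 * b x)).
have ki0 : 0 < k^-1 by rewrite invr_gt0.
have dli0 : 0 < dl^-1 by rewrite invr_gt0.
have ke0 x : 0 <= k^-1 * e x by apply: mulr_ge0; [exact: ltW|exact: dv0].
have db0 x : 0 <= dl^-1 * b x by apply: mulr_ge0; [exact: ltW|exact: b0].
have U1U x : 0 <= U1 x <= U x.
  rewrite /U1 le_max lexx ge_max /=; have /andP[-> _] := U01 x.
  by rewrite gerBl addr_ge0.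
have U1pos x : 0 < U1 x -> e x < k * U x.
  rewrite /U1 lt_max ltxx /= => h.
  have : k^-1 * e x < U x by have := db0 x; lra.
  by rewrite mulrC ltr_pdivrMr // mulrC.
have getac a : 0 < a -> unif_cont_on d dV [set x | a <= U x] (g \o eta).
  move=> a0 a' /gc[del1 del10 H1]; have [del del0 H] := etac _ a0 _ del10.
  by exists del => // x x' ax ax' xx; apply: H1 => //; exact: H.
have ec a : 0 < a -> unif_cont_on d rdist [set x | a <= U x] e.
  move=> a0 a' a'0; have a20 : 0 < a' / 2 by lra.
  have [d1 d10 H1] := cc _ a20; have [d2 d20 H2] := getac _ a0 _ a20.
  exists (Num.min d1 d2); first by rewrite lt_min d10.
  move=> x x' ax ax'; rewrite lt_min => /andP[xx1 xx2].
  have := H1 _ _ I I xx1; have := H2 _ _ ax ax' xx2; rewrite /= /e /rdist.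
  have := dvt (c x) (c x') (g (eta x)); have := dvt (c x') (g (eta x')) (g (eta x)).
  have := dvt (c x') (c x) (g (eta x')); have := dvt (c x) (g (eta x)) (g (eta x')).
  rewrite (dvs (c x') (c x)) (dvs (g (eta x')) (g (eta x))) => *.
  by rewrite ltr_norml; apply/andP; split; lra.
have rp : pseudometric (rdist (R := R)).
  rewrite /rdist; split=> [x x'|x|x x'|x x' z]; first exact: normr_ge0.
  - by rewrite subrr normr0.
  - by rewrite distrC.
  - exact: ler_distD.
have U1c : unif_cont_on d rdist setT U1.
  apply: (unif_cont_squash (l := U) (w0 := fun=> 0 : R) rp Uc).
  - by move=> a a0; exists 1 => // x x' _ _ _; rewrite /rdist subrr normr0.
  - move=> a a0 a' a'0; have a30 : 0 < a' / 3 by lra.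
    have [d1 d10 H1] := Uc _ a30.
    have [d2 d20 H2] := ec _ a0 _ (mulr_gt0 k0 a30).
    have [d3 d30 H3] := bc _ (mulr_gt0 dl0 a30).
    exists (Num.min d1 (Num.min d2 d3)); first by rewrite !lt_min d10 d20.
    move=> x x' [_ ax] [_ ax']; rewrite !lt_min => /and3P[xx1 xx2 xx3].
    apply: dist_max_lt; first by rewrite subrr normr0.
    have := H1 _ _ I I xx1 => /lt_dist[? ?].
    have := H2 _ _ ax ax' xx2; rewrite -ltr_pdivrMl // -(gtr0_norm ki0) -normrM.
    rewrite (gtr0_norm ki0) mulrBr => /lt_dist[? ?].
    have := H3 _ _ I I xx3; rewrite -ltr_pdivrMl // -(gtr0_norm dli0) -normrM.
    rewrite (gtr0_norm dli0) mulrBr => /lt_dist[? ?].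
    by rewrite ltr_norml; apply/andP; split; lra.
  - move=> a a0; exists a => // x _ Ux; rewrite /rdist subr0.
    by have /andP[? ?] := U1U x; rewrite ger0_norm //; lra.
pose t x := Num.min 1 (2 * (U1 x / U x)).
pose c' x := if 0 < U1 x then G (c x) (g (eta x)) (t x) else c x.
have c'c : unif_cont_on d dV setT c'.
  apply: (unif_cont_squash (l := U1) (w0 := c) dVP U1c cc).
  - move=> a a0 a' a'0; have [q q0 Hq] := Gc _ a'0.
    have q20 : 0 < q / 2 by lra.
    have m0 : 0 < q / 2 * a ^+ 2 / 2 by rewrite divr_gt0 // mulr_gt0 // exprn_gt0.
    have [d1 d10 H1] := cc _ q0; have [d2 d20 H2] := getac _ a0 _ q0.
    have [d3 d30 H3] := Uc _ m0; have [d4 d40 H4] := U1c _ m0.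
    exists (Num.min (Num.min d1 d2) (Num.min d3 d4)); first by rewrite !lt_min d10 d20 d30.
    move=> x x' [_ ax] [_ ax']; rewrite !lt_min => /andP[/andP[xx1 xx2] /andP[xx3 xx4]].
    rewrite /c' !(lt_le_trans a0) //.
    have /andP[U1x U1Ux] := U1U x; have /andP[U1x' U1Ux'] := U1U x'.
    have /andP[_ Ux1] := U01 x; have /andP[_ Ux1'] := U01 x'.
    apply: Hq; first exact: H1.
      by apply: H2 => //=; lra.
    apply: dist_min_lt; first by rewrite subrr normr0.
    rewrite -mulrBr normrM (ger0_norm (ler0n _ _)) -ltr_pdivlMl // (mulrC _ q).
    apply: (quotient_dist a0 q20); [by apply/andP; split; lra| | | |].
    + by apply/andP; split; lra.
    + by apply/andP; split; lra.
    + exact: H4.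
    + exact: H3.
  - move=> a a0; have [q q0 Hq] := Gnear _ a0.
    exists (k^-1 * q * q / 2); first by rewrite divr_gt0 // !mulr_gt0.
    move=> x _ U1x; rewrite /c'; case: ifPn => U1p; last by rewrite dvxx.
    apply: Hq; have [Uq|Uq] := ltP (U x) (k^-1 * q).
      left; apply: (lt_trans (U1pos _ U1p)).
      by rewrite -ltr_pdivlMl.
    right; rewrite gt_min; apply/orP; right.
    have Up : 0 < U x by rewrite (lt_le_trans _ Uq) // mulr_gt0.
    rewrite mulrA ltr_pdivrMr //.
    have : k^-1 * q * q <= U x * q by rewrite ler_pM2r.
    by rewrite (mulrC q); lra.
pose U2 x := Num.max 0 (2 * U1 x - U x).
have U2U x : 0 <= U2 x <= U1 x.
  rewrite /U2 le_max lexx ge_max /=; have /andP[-> ?] := U1U x.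
  by rewrite /=; lra.
have U2pos x : 0 < U2 x -> 0 < U1 x /\ c' x = g (eta x).
  rewrite /U2 lt_max ltxx /= => h; have /andP[? ?] := U1U x.
  have U1p : 0 < U1 x by lra.
  split=> //; rewrite /c' U1p G1 // /t le_min lexx /= mulrA ler_pdivlMr; lra.
have U2r x : 0 < U2 x -> 0 < U2 x <= 1.
  move=> -> /=; have /andP[_ h2] := U2U x; have /andP[_ h1] := U1U x.
  by have /andP[_ h] := U01 x; lra.
(* Both formulas give the retraction [c'] and the level [U2]. *)
pose h x := if 0 < U2 x then cyl_seg C (eta x) (U2 x) else cyl_base C (c' x).
have hr x : cyl_retr C (h x) = c' x.
  rewrite /h; case: ifPn => [p|_]; last exact: cyl_retr_base.
  by rewrite cyl_retr_seg ?U2r // (U2pos _ p).2.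
have hl x : cyl_lev C (h x) = U2 x.
  rewrite /h; case: ifPn => [p|]; first by rewrite cyl_lev_seg // U2r.
  rewrite -leNgt cyl_lev_base => p; apply/eqP; rewrite eq_le p.
  by have /andP[->] := U2U x.
have hp x : 0 < U2 x -> cyl_pt C (h x) = Some (eta x).
  by rewrite /h => p; rewrite p cyl_pt_seg // U2r.
have c'0 x : U1 x <= 0 -> c' x = c x by rewrite /c' ltNge => ->.
have h0 x : U1 x <= 0 -> h x = cyl_base C (c x).
  move=> U1x; rewrite -c'0 // /h ltNge.
  by have /andP[_ /le_trans ->] := U2U x.
exists h; split.
- apply: cyl_unif_cont => //.
  + by move=> a /c'c[del del0 H]; exists del => // x x'; rewrite /= !hr; exact: H.
  + move=> a a0; have a40 : 0 < a / 4 by lra.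
    have [d1 d10 H1] := Uc _ a40; have [d2 d20 H2] := U1c _ a40.
    exists (Num.min d1 d2); first by rewrite lt_min d10.
    move=> x x' _ _; rewrite lt_min /= /rdist !hl => /andP[xx1 xx2].
    apply: dist_max_lt; first by rewrite subrr normr0.
    have /lt_dist[? ?] := H1 _ _ I I xx1; have /lt_dist[? ?] := H2 _ _ I I xx2.
    by rewrite ltr_norml; apply/andP; split; lra.
  + move=> a a0 a' a'0; have [del del0 H] := etac _ a0 _ a'0.
    exists del => // x x' [_]; rewrite hl => ax [_]; rewrite hl => ax' xx.
    rewrite /= !hp ?(lt_le_trans a0) //=; apply: H => //=.
      by have /andP[? ?] := U1U x; have /andP[? ?] := U2U x; lra.
    by have /andP[? ?] := U1U x'; have /andP[? ?] := U2U x'; lra.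
- move=> x bx; have Ux := Uu _ bx; have /andP[U1x U1Ux] := U1U x.
  have cfx := cf _ bx.
  case: (cyl_cases C (f x)) => [fx|[p lp fx]].
    rewrite h0 ?cfx //; move: U1Ux; rewrite Ux /u fx cyl_lev_base; exact: id.
  have ux : 0 < u x by case/andP: lp.
  have yp : y x = p by rewrite /y fx cyl_pt_seg.
  have ex : e x = 0.
    by rewrite /e etay // yp cfx fx cyl_retr_seg // dvxx.
  have U1e : U1 x = u x.
    rewrite /U1 ex bx !mulr0 addr0 subr0 Ux; apply/max_idPr.
    by rewrite ltW.
  have U2e : U2 x = u x.
    by rewrite /U2 U1e Ux mulr_natl mulr2n addrK; apply/max_idPr; rewrite ltW.
  by rewrite /h U2e ux etay // yp -fx.
- move=> x; rewrite hr; have [U1x|U1x] := leP (U1 x) 0.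
    by rewrite c'0 // dvxx.
  rewrite /c' U1x; apply: Hk; left.
  have := U1pos _ U1x; have /andP[_ ?] := U01 x; rewrite -/(e x) => h1.
  by apply: (lt_le_trans h1); rewrite ler_piMr // ltW.
- move=> x bx; apply: h0; rewrite /U1 ge_max lexx /=.
  have : 1 <= dl^-1 * b x by rewrite -ler_pdivrMl ?invrK ?mulr1.
  by have := ke0 x; have /andP[_ ?] := U01 x; lra.
Qed.

Lemma cyl_absolute_extensor : absolute_extensor D.
Proof.
move=> T d b f dd b0 bc fc.
have [|c cc cf] := Vae (f := cyl_retr C \o f) dd b0 bc.
  move=> e /fc[del del0 H]; exists del => // x x' bx bx' /(H _ _ bx bx').
  by apply: le_lt_trans; exact: cyl_retr_lip.
have [h [hc hf _ _]] := cyl_lift dd b0 bc fc cc cf ltr01 ltr01.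
by exists h.
Qed.

End Lift.
End Cylinder.

(** * Uniformities, quotients and limits through pseudometrics *)

Section Pseudometrics.
Variable R : realType.

Definition pm_ent (T : Type) (d : T -> T -> R) : set_system (T * T) :=
  [set E | exists2 eps, 0 < eps & forall x y, d x y < eps -> E (x, y)].

Definition metrizes (U : uniformType) (d : U -> U -> R) : Prop :=
  @entourage U = pm_ent d.

Lemma pm_ent_filter (T : Type) (d : T -> T -> R) : Filter (pm_ent d).
Proof.
split.
- by exists 1.
- move=> A B [a a0 aA] [b b0 bB]; exists (Num.min a b); first by rewrite lt_min a0.
  by move=> x y; rewrite lt_min => /andP[/aA ? /bB].
- by move=> A B AB [a a0 aA]; exists a => // x y /aA /AB.
Qed.

Section PmEnt.
Variables (T : Type) (d : T -> T -> R).
Hypothesis dP : pseudometric d.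

Lemma pm_ent_diagonal A : pm_ent d A -> (diagonal `<=` A)%classic.
Proof.
case: dP => _ d0 _ _ [e e0 eA] [x y] /diagonalP ->; apply: eA.
by rewrite d0.
Qed.

Lemma pm_ent_inv A : pm_ent d A -> pm_ent d (A^-1)%relation.
Proof.
by case: dP => _ _ ds _ [e e0 eA]; exists e => // x y; rewrite ds => /eA.
Qed.

Lemma pm_ent_split A : pm_ent d A ->
  exists2 B, pm_ent d B & ((B \; B)%relation `<=` A).
Proof.
case: dP => _ _ _ dt [e e0 eA]; exists [set xy | d xy.1 xy.2 < e / 2].
  by exists (e / 2) => //; rewrite divr_gt0.
move=> [x z] [y /= xy yz]; apply: eA; apply: (le_lt_trans (dt _ y _)).
by rewrite [e]splitr ltrD.
Qed.

Lemma pm_ent_uniformity : is_uniformity (pm_ent d).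
Proof.
split; [exact: pm_ent_filter|exact: pm_ent_diagonal|exact: pm_ent_inv|].
exact: pm_ent_split.
Qed.

End PmEnt.

(** Truncating the metric at 1 does not change the uniformity. *)
Lemma metrizable_metrizes (U : uniformType) : metrizable R U ->
  exists d : U -> U -> R,
    [/\ pseudometric d, metrizes d, forall x y, d x y = 0 -> x = y
      & forall x y, d x y <= 1].
Proof.
move=> [d [d0 dE ds dt uE]].
exists (fun x y => Num.min (d x y) 1); split.
- split=> [x y|x|x y|x y z].
  + by rewrite le_min d0 ler01.
  + by rewrite (dE x x).2// minEle ler01.
  + by rewrite ds.
  + have := dt x y z; have := d0 x y; have := d0 y z.
    by rewrite !minEle; do 3 case: ifPn; rewrite -?ltNge; lra.
- rewrite /metrizes uE; apply/seteqP; split=> E.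
    move=> [e /= e0 eE]; exists (Num.min e 1); first by rewrite lt_min e0 ltr01.
    move=> x y; rewrite lt_min !gt_min ltxx orbF => /andP[xye xy1].
    by apply: (eE (x, y)) => /=; case/orP: xye => // /(lt_trans xy1).
  move=> [e e0 eE]; exists e => //= -[x y] /= xy; apply: eE.
  by rewrite gt_min xy.
- move=> x y; rewrite minEle; case: ifPn => _; first by move/dE.
  by move/eqP; rewrite oner_eq0.
- by move=> x y; rewrite ge_min lexx orbT.
Qed.

Lemma metrizes_unif_continuous (U V : uniformType) d e (f : U -> V) :
  metrizes d -> metrizes e ->
  unif_continuous f <-> unif_cont_on d e setT f.
Proof.
move=> dE eE; rewrite /unif_continuous dE eE; split=> [fc eps eps0|fc E].
  have [del del0 H] : pm_ent d ((fun xy => (f xy.1, f xy.2)) @^-1` [set xy | e xy.1 xy.2 < eps]).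
    by apply: fc; exists eps.
  by exists del => // x y _ _ /H.
move=> [eps eps0 epsE]; have [del del0 H] := fc _ eps0.
by exists del => // x y xy; apply: epsE; apply: H.
Qed.

(** The balls of a pseudometric generate a uniformity, to which the universal
    property of the quotient applies. *)
Lemma uquot_ball_entourage (U : uniformType) (r : U -> U -> Prop)
    (d : uquot r -> uquot r -> R) : pseudometric d ->
  (forall eps, 0 < eps -> entourage
     [set xy : U * U | d (uquot_pi r xy.1) (uquot_pi r xy.2) < eps]) ->
  forall eps, 0 < eps -> entourage [set ab | d ab.1 ab.2 < eps].
Proof.
move=> dP dc eps eps0.
apply: (uquot_ent_finest (E := pm_ent d)).
- exact: pm_ent_uniformity.
- move=> A [e e0 eA]; apply: filterS (dc e e0) => -[x y] /= xy.
  exact: eA.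
- by exists eps.
Qed.

Lemma invlim_ent_proj (X : nat -> uniformType) (p : forall n, X n.+1 -> X n)
    n (E : set (X n * X n)) : entourage E ->
  entourage [set xy : invlim p * invlim p |
              E (invlim_proj n xy.1, invlim_proj n xy.2)].
Proof.
move=> eE.
suff H : @entourage (prod_topology X) [set xy | E (xy.1 n, xy.2 n)].
  by exists [set xy | E (xy.1 n, xy.2 n)].
pose Tc i := Uniform.class (initial_topology (@proj _ X i)).
pose A : set ((forall i, X i) * (forall i, X i)) := [set xy | E (xy.1 n, xy.2 n)].
have eA : @entourage (Uniform.Pack (Tc n)) A by exists E.
exists A => //.
have hA : `[< @entourage (Uniform.Pack (Tc n)) A >] by exact/asboolP.
unshelve eexists (fset1 _); first exact: (exist _ (n, A) hA).
  by move=> ? _; rewrite in_setT.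
apply/seteqP; split=> z /=; last by move=> Az i /fset1P ->.
move=> Hz; apply: (Hz (exist _ (n, A) hA)); exact/fset1P.
Qed.

(** The uniformity of the limit is generated by the projections. *)
Lemma invlim_ent_sub (X : nat -> uniformType) (p : forall n, X n.+1 -> X n)
    (G : set_system (invlim p * invlim p)) : Filter G ->
  (forall n (E : set (X n * X n)), entourage E ->
     G [set xy | E (invlim_proj n xy.1, invlim_proj n xy.2)]) ->
  entourage `<=` G.
Proof.
move=> FG GE A [B [C [F _ FC] CB] BA].
pose pr (xy : invlim p * invlim p) := (set_val xy.1, set_val xy.2).
suff : G (\bigcap_(i in [set` F]) (pr @^-1` (projT1 i).2)).
  apply: filterS => xy Hxy; apply: BA; apply: CB; rewrite -FC => i iF.
  exact: Hxy.
apply: filter_bigI => -[[i D] /= /[dup] Di /asboolP [D' eD' DD']] _.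
by apply: filterS (GE i _ eD') => xy /= Dxy; apply: DD'.
Qed.

End Pseudometrics.

Section MetrizeProducts.
Variable R : realType.

Lemma metrizes_ball (U : uniformType) (d : U -> U -> R) e : metrizes d -> 0 < e ->
  entourage [set xy | d xy.1 xy.2 < e].
Proof. by rewrite /metrizes => -> e0; exists e. Qed.

Lemma metrizes_sub (U : uniformType) (d : U -> U -> R) (E : set (U * U)) :
  metrizes d -> entourage E -> exists2 e, 0 < e & forall x y, d x y < e -> E (x, y).
Proof. by rewrite /metrizes => ->. Qed.

Lemma metrizesP (U : uniformType) (d : U -> U -> R) :
  (forall e, 0 < e -> entourage [set xy | d xy.1 xy.2 < e]) ->
  (forall E : set (U * U), entourage E ->
     exists2 e, 0 < e & forall x y, d x y < e -> E (x, y)) ->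
  metrizes d.
Proof.
move=> H1 H2; apply/seteqP; split=> E; first by move/H2.
by move=> [e e0 eE]; apply: filterS (H1 e e0) => -[x y] /eE.
Qed.

Definition ui_dist (s t : unit_interval R) : R := `|ui_val s - ui_val t|.

Definition prod_dist (U V : Type) (d : U -> U -> R) (e : V -> V -> R) (x y : U * V) : R :=
  d x.1 y.1 + e x.2 y.2.

Lemma ui_dist_pm : pseudometric ui_dist.
Proof.
rewrite /ui_dist; split=> [x x'|x|x x'|x x' z]; first exact: normr_ge0.
- by rewrite subrr normr0.
- by rewrite distrC.
- exact: ler_distD.
Qed.

Lemma prod_dist_pm (U V : Type) (d : U -> U -> R) (e : V -> V -> R) :
  pseudometric d -> pseudometric e -> pseudometric (prod_dist d e).
Proof.
move=> [d0 dxx ds dt] [e0 exx es et]; rewrite /prod_dist; split=> [x y|x|x y|x y z].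
- by rewrite addr_ge0.
- by rewrite dxx exx addr0.
- by rewrite ds es.
- by have := dt x.1 y.1 z.1; have := et x.2 y.2 z.2; lra.
Qed.

Lemma metrizes_ui : metrizes ui_dist.
Proof.
apply: metrizesP => [e e0|E [A]].
  exists [set xy : R * R | ball xy.1 e xy.2]; first exact: (entourage_ball R (PosNum e0)).
  by move=> [x y].
rewrite -entourage_ballE => -[e /= e0 eA] AE; exists e => // x y xy.
by apply: AE; apply: (eA (set_val x, set_val y)).
Qed.

Lemma metrizes_prod (U V : uniformType) (d : U -> U -> R) (e : V -> V -> R) :
  pseudometric d -> pseudometric e ->
  metrizes d -> metrizes e -> metrizes (prod_dist d e).
Proof.
move=> [d0 _ _ _] [e0 _ _ _] dU eV; apply: metrizesP => [a a0|E [[A B] [/= eA eB] AB]].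
  have a20 : 0 < a / 2 by lra.
  apply: filterS (prod_entP (metrizes_ball dU a20) (metrizes_ball eV a20)).
  by move=> [x y] /= [h1 h2]; rewrite /prod_dist; lra.
have [a a0 aA] := metrizes_sub dU eA; have [b b0 bB] := metrizes_sub eV eB.
exists (Num.min a b); first by rewrite lt_min a0.
move=> x y; rewrite lt_min => /andP[xa xb].
have [|[p q] Epq [e1 e2 e3 e4]] := AB ((x.1, y.1), (x.2, y.2)).
  split; [apply: aA|apply: bB].
    by apply: le_lt_trans xa; rewrite lerDl.
  by apply: le_lt_trans xb; rewrite lerDr.
by move: Epq; rewrite [p]surjective_pairing [q]surjective_pairing e1 e2 e3 e4 -!surjective_pairing.
Qed.

End MetrizeProducts.

(** * The metric of the finite telescopes *)

Section TelCylinder.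
Variables (R : realType) (Z : nat -> uniformType) (g : forall n, Z n.+1 -> Z n).
Local Notation tel := (tel R g).
Local Notation telend m := (@tel_end R Z m (Defs.telescope R g m)).
Local Notation mbase m := (@mc_base R _ _ (@g m)).
Local Notation ainl m := (@am_inl _ _ _ (telend m) (mbase m)).
Local Notation ainr m := (@am_inr _ _ _ (telend m) (mbase m)).

Lemma clip_proof (t : R) : 0 <= Num.max 0 (Num.min 1 t) <= 1.
Proof. by rewrite le_max lexx ge_max ler01 /= ge_min lexx. Qed.

Definition ui_clip (t : R) : unit_interval R := ui_mk (clip_proof t).

Lemma ui_clip_val (t : R) : 0 <= t <= 1 -> ui_val (ui_clip t) = t.
Proof.
move=> /andP[t0 t1]; rewrite -[LHS]/(Num.max 0 (Num.min 1 t)).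
by rewrite (min_idPr _) // (max_idPr _).
Qed.

Lemma ui_clipK (t : unit_interval R) : ui_clip (ui_val t) = t.
Proof. by apply: val_inj; apply: ui_clip_val; exact: (set_valP t). Qed.

Definition tel_lev m : tel m.+1 -> R :=
  am_rec (i := telend m) (j := mbase m) (fun=> 0) (@mc_height R _ _ (@g m)).

Definition mc_pt m : mcyl R (@g m) -> option (Z m.+1) :=
  uquot_lift (fun a : mc_pre R (Z m.+1) (Z m) =>
    match a with inl xt => if ui_val xt.2 < 1 then Some xt.1 else None | inr _ => None end).

Definition tel_pt m : tel m.+1 -> option (Z m.+1) :=
  am_rec (i := telend m) (j := mbase m) (fun=> None) (@mc_pt m).

Lemma mc_pt_glue m (a b : mc_pre R (Z m.+1) (Z m)) : mc_glue (@g m) a b ->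
  match a with inl xt => if ui_val xt.2 < 1 then Some xt.1 else None | inr _ => None end =
  match b with inl xt => if ui_val xt.2 < 1 then Some xt.1 else None | inr _ => None end.
Proof. by move=> [x [-> ->]] /=; rewrite /ui_val /= ltxx. Qed.

Lemma mc_pt_seg m x t : mc_pt (mc_seg (@g m) x t) = if ui_val t < 1 then Some x else None.
Proof. by rewrite /mc_pt uquot_liftE //; exact: mc_pt_glue. Qed.

Lemma mc_pt_base m y : mc_pt (mbase m y) = None.
Proof. by rewrite /mc_pt uquot_liftE //; exact: mc_pt_glue. Qed.

Lemma tel_lev_inl m v : tel_lev (ainl m v) = 0.
Proof. by rewrite /tel_lev am_rec_inl // => z /=; rewrite mc_height_base. Qed.

Lemma tel_lev_inr m c : tel_lev (ainr m c) = mc_height c.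
Proof. by rewrite /tel_lev am_rec_inr // => z /=; rewrite mc_height_base. Qed.

Lemma tel_pt_inr m c : tel_pt (ainr m c) = mc_pt c.
Proof. by rewrite /tel_pt am_rec_inr // => z /=; rewrite mc_pt_base. Qed.

Lemma tel_retr_inl m v : tel_retr (ainl m v) = v.
Proof. by rewrite /tel_retr am_rec_inl // => z /=; rewrite mc_collapse_base. Qed.

Lemma tel_retr_inr m c : tel_retr (ainr m c) = telend m (mc_collapse c).
Proof. by rewrite /tel_retr am_rec_inr // => z /=; rewrite mc_collapse_base. Qed.

Lemma inr_base m y : ainr m (mbase m y) = ainl m (telend m y).
Proof. by rewrite am_glueE. Qed.

(** The segment of the last cylinder through [x], parametrized by the level
    [h] above the base; the cylinder coordinate is [1 - h]. *)
Definition tel_seg m (x : Z m.+1) (h : R) : tel m.+1 :=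
  ainr m (mc_seg (@g m) x (ui_clip (1 - h))).

Lemma tel_seg_lev m x h : 0 <= h <= 1 -> tel_lev (@tel_seg m x h) = h.
Proof. by move=> h01; rewrite /tel_seg tel_lev_inr mc_height_seg ui_clip_val; lra. Qed.

Lemma tel_seg_retr m x h : tel_retr (@tel_seg m x h) = telend m (g x).
Proof. by rewrite tel_retr_inr mc_collapse_seg. Qed.

Lemma tel_seg_pt m x h : 0 < h <= 1 -> tel_pt (@tel_seg m x h) = Some x.
Proof.
move=> h01; rewrite tel_pt_inr mc_pt_seg ui_clip_val; last lra.
by rewrite gtrBl; case/andP: h01 => ->.
Qed.

Lemma tel_seg0 m x : @tel_seg m x 0 = ainl m (telend m (g x)).
Proof.
rewrite -inr_base -mc_glueE /tel_seg subr0; congr (am_inr _ _ (mc_seg _ _ _)).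
by rewrite -[RHS]ui_clipK.
Qed.

Lemma tel_end_seg m x : telend m.+1 x = @tel_seg m x 1.
Proof.
rewrite /tel_seg /= subrr; congr (am_inr _ _ (mc_seg _ _ _)).
by rewrite -[LHS]ui_clipK.
Qed.

Lemma tel_cases m (a : tel m.+1) : a = ainl m (tel_retr a) \/
  exists2 x, 0 < tel_lev a <= 1 & a = tel_seg x (tel_lev a).
Proof.
elim/amalg_ind: a => [v|c]; first by left; rewrite tel_retr_inl.
elim/mcyl_ind: c => [x t|y]; last first.
  by left; rewrite inr_base tel_retr_inl.
have /andP[t0 t1] : 0 <= ui_val t <= 1 by exact: (set_valP t).
have -> : ainr m (mc_seg (@g m) x t) = tel_seg x (1 - ui_val t).
  by rewrite /tel_seg opprB addrCA subrr addr0 ui_clipK.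
have [lt1|] := ltP (ui_val t) 1.
  by right; exists x; rewrite tel_seg_lev //; lra.
move=> ge1; have -> : 1 - ui_val t = 0 by lra.
by left; rewrite tel_seg0 tel_retr_inl.
Qed.

Definition tel_cyl m : cylinder R (tel m.+1) (telend m \o @g m) :=
  @Cylinder R (tel m) (Z m.+1) (tel m.+1) (telend m \o @g m)
    (ainl m) (@tel_seg m) (@tel_retr R Z g m) (@tel_lev m) (@tel_pt m)
    (@tel_retr_inl m) (@tel_lev_inl m)
    (fun x h _ => @tel_seg_retr m x h)
    (fun x h h01 => @tel_seg_lev m x h (introT andP (conj (ltW (andP h01).1) (andP h01).2)))
    (@tel_seg_pt m) (@tel_cases m).

Variable dZ : forall n, Z n -> Z n -> R.
Hypothesis dZP : forall n, pseudometric (@dZ n).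
Hypothesis dZ1 : forall n x y, @dZ n x y <= 1.
Hypothesis dZm : forall n, metrizes (@dZ n).
Hypothesis gc : forall n, unif_continuous (@g n).

Fixpoint tel_dist (m : nat) : tel m -> tel m -> R :=
  match m return tel m -> tel m -> R with
  | 0%N => @dZ 0
  | k.+1 => cyl_dist (tel_cyl k) (@tel_dist k) (@dZ k.+1)
  end.

Lemma tel_dist_pm m : pseudometric (@tel_dist m).
Proof.
elim: m => [|m IH]; first exact: dZP.
exact: (cyl_dist_pm (tel_cyl m) IH (dZP m.+1) (@dZ1 m.+1)).
Qed.

Lemma tel_dist_sep : (forall n x y, @dZ n x y = 0 -> x = y) ->
  forall m x y, @tel_dist m x y = 0 -> x = y.
Proof.
move=> sep; elim=> [|m IH] x y /=; first exact: sep.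
apply: cyl_dist_sep => //; [exact: tel_dist_pm|exact: sep].
Qed.

Section Step.
Variable m : nat.
Hypothesis Vm : metrizes (@tel_dist m).
Hypothesis endc : unif_cont_on (@dZ m) (@tel_dist m) setT (telend m).

Lemma tel_base_dist v v' : @tel_dist m.+1 (ainl m v) (ainl m v') = @tel_dist m v v'.
Proof.
rewrite /= /cyl_dist /= !tel_retr_inl !tel_lev_inl subrr normr0 addr0.
by rewrite minxx mul0r addr0.
Qed.

(** By the universal property of the two quotients, it is enough to bound the
    distance on the base and on the segments. *)
Lemma tel_ball_entourage e : 0 < e -> entourage [set ab | @tel_dist m.+1 ab.1 ab.2 < e].
Proof.
have [odP od1] := option_dist_pm (dZP m.+1) (@dZ1 m.+1).
have [d0 dxx ds dt] := tel_dist_pm m.+1.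
move: e; apply: (uquot_ball_entourage (tel_dist_pm m.+1)).
move=> e e0; split.
  apply: filterS (metrizes_ball Vm e0) => -[v v'] /=.
  by rewrite -tel_base_dist.
have mcd : pseudometric (fun c c' : mcyl R (@g m) => @tel_dist m.+1 (ainr m c) (ainr m c')).
  by split.
move: e e0; apply: (uquot_ball_entourage mcd) => e e0; split; last first.
  have [d d_0 H] := endc e0.
  apply: filterS (metrizes_ball (dZm m) d_0) => -[y y'] /= yy.
  rewrite -/(mbase m y) -/(mbase m y') !inr_base.
  by rewrite -[X in X < _]/(@tel_dist m.+1 _ _) tel_base_dist; apply: H.
have e30 : 0 < e / 3 by lra.
have [d1 d10 H1] := endc e30.
have [d2 d20 H2] := (metrizes_unif_continuous (@g m) (dZm m.+1) (dZm m)).1 (@gc m) _ d10.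
have PI := metrizes_prod (dZP m.+1) (ui_dist_pm R) (dZm m.+1) (metrizes_ui R).
have m0 : 0 < Num.min d2 (e / 3) by rewrite lt_min d20.
apply: filterS (metrizes_ball PI m0) => -[[x t] [x' t']] /=.
rewrite /prod_dist /ui_dist /= lt_min => /andP[xd xe].
rewrite -/(mc_seg (@g m) x t) -/(mc_seg (@g m) x' t').
have [z0 _ _ _] := dZP m.+1.
have n0 := normr_ge0 (ui_val t - ui_val t').
rewrite /cyl_dist /= !tel_retr_inr !tel_lev_inr !tel_pt_inr !mc_height_seg !mc_collapse_seg !mc_pt_seg.
have h1 : @tel_dist m (telend m (g x)) (telend m (g x')) < e / 3.
  by apply: H1 => //; apply: H2 => //; have := z0 x x'; lra.
have h2 : `|1 - ui_val t - (1 - ui_val t')| < e / 3.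
  rewrite (_ : _ - _ = - (ui_val t - ui_val t')); last by ring.
  by rewrite normrN; have := z0 x x'; lra.
have /andP[t0 t1] : 0 <= ui_val t <= 1 by exact: (set_valP t).
have /andP[t0' t1'] : 0 <= ui_val t' <= 1 by exact: (set_valP t').
have h3 : Num.min (1 - ui_val t) (1 - ui_val t') * option_dist (@dZ m.+1)
    (if ui_val t < 1 then Some x else None) (if ui_val t' < 1 then Some x' else None) < e / 3.
  have [tl|tl] := ltP (ui_val t) 1; last first.
    by rewrite (_ : Num.min _ _ = 0) ?mul0r //; apply/eqP; rewrite eq_le ge_min le_min; lra.
  have [tl'|tl'] := ltP (ui_val t') 1; last first.
    by rewrite (_ : Num.min _ _ = 0) ?mul0r //; apply/eqP; rewrite eq_le ge_min le_min; lra.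
  apply: (@le_lt_trans _ _ (@dZ m.+1 x x')); last lra.
  by rewrite /= ler_piMl // ge_min; apply/orP; left; lra.
by lra.
Qed.

(** At levels bounded away from 0 close points have close coordinates in
    [Z m.+1].  A point of small level is close to its retraction along its segment,
    so two points of small level are close as soon as their retractions are. *)
Lemma tel_entourage_sub (E : set (tel m.+1 * tel m.+1)) : entourage E ->
  exists2 e, 0 < e & forall a b, @tel_dist m.+1 a b < e -> E (a, b).
Proof.
move=> eE.
pose E1 := split_ent E; pose E2 := split_ent E1; pose F := E2 `&` E2^-1%relation.
have eE1 : entourage E1 by exact: entourage_split_ent.
have eF : entourage F by apply: entourage_invI; exact: entourage_split_ent.
have Fs a b : F (a, b) -> F (b, a) by move=> [].
have FE1 a b : F (a, b) -> E1 (a, b) by move=> [h _]; exact: split_ent_subset.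
have F3 a b c d : F (a, b) -> F (b, c) -> F (c, d) -> E (a, d).
  move=> ab bc cd; apply: (entourage_split c) => //; last exact: FE1.
  by apply: (entourage_split b) => //; [case: ab|case: bc].
have FE a b : F (a, b) -> E (a, b).
  by move=> /FE1 ?; exact: split_ent_subset.
have [eFl eFr] : entourage [set xy : tel m * tel m | F (ainl m xy.1, ainl m xy.2)] /\
    entourage [set xy : mcyl R (@g m) * mcyl R (@g m) | F (ainr m xy.1, ainr m xy.2)].
  by have := uquot_pi_unif_continuous (r := am_glue (telend m) (mbase m)) eF; case.
have [eFs _] := uquot_pi_unif_continuous (r := mc_glue (@g m)) eFr.
have [e1 e10 H1] := metrizes_sub Vm eFl.
have PI := metrizes_prod (dZP m.+1) (ui_dist_pm R) (dZm m.+1) (metrizes_ui R).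
have [e2 e20 H2] := metrizes_sub PI eFs.
have {}H2 x t x' t' : @dZ m.+1 x x' + ui_dist t t' < e2 ->
    F (ainr m (mc_seg (@g m) x t), ainr m (mc_seg (@g m) x' t')).
  exact: (H2 (x, t) (x', t')).
have {}H2 x h x' h' : 0 <= h <= 1 -> 0 <= h' <= 1 ->
    @dZ m.+1 x x' + `|h - h'| < e2 -> F (tel_seg x h, tel_seg x' h').
  move=> h01 h01' xx; apply: H2; apply: le_lt_trans xx; rewrite lerD2l.
  rewrite /ui_dist !ui_clip_val; try lra.
  by rewrite distrC (_ : _ - _ = h - h') //; ring.
have [z0 zxx _ _] := dZP m.+1.
have low a : tel_lev a < e2 -> F (a, ainl m (tel_retr a)).
  case: (tel_cases a) => [{2}->|[x la ax]] le; first exact: entourage_refl.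
  rewrite {2}ax tel_seg_retr -tel_seg0 {1}ax; apply: H2; [lra|by rewrite lexx ler01|].
  by rewrite zxx add0r subr0 gtr0_norm; [|case/andP: la].
pose s := e2 / 2.
have s0 : 0 < s by rewrite /s; lra.
(* [s] bounds the levels, and [s * s] the coordinates at levels above [s]. *)
exists (Num.min e1 (Num.min s (s * s))); first by rewrite !lt_min e10 s0 mulr_gt0.
move=> a b; rewrite !lt_min => /and3P[ab1 ab2 ab3].
have ret : @tel_dist m (tel_retr a) (tel_retr b) < e1.
  by apply: le_lt_trans ab1; apply: (cyl_retr_lip (tel_cyl m)) => //; exact: tel_dist_pm.
have lev : `|tel_lev a - tel_lev b| < s.
  by apply: le_lt_trans ab2; apply: (cyl_lev_lip (tel_cyl m)) => //; exact: tel_dist_pm.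
have /lt_dist[l1 l2] := lev.
have lows : tel_lev a < e2 -> tel_lev b < e2 -> E (a, b).
  move=> /low la /low lb; apply: (F3 _ _ _ _ la _ (Fs _ _ lb)).
  exact: H1.
have [sa|sa] := leP s (tel_lev a); last by apply: lows; rewrite /s in sa l2 *; lra.
have [sb|sb] := leP s (tel_lev b); last by apply: lows; rewrite /s in sb l1 *; lra.
have := cyl_pt_lip (C := tel_cyl m) (tel_dist_pm m) (dZP m.+1) (@dZ1 m.+1) sa sb.
case: (tel_cases a) => [ea|[x la ea]].
  by move: sa; rewrite ea tel_lev_inl leNgt s0.
case: (tel_cases b) => [eb|[y lb eb]].
  by move: sb; rewrite eb tel_lev_inl leNgt s0.
have pa : tel_pt a = Some x by rewrite ea tel_seg_pt.
have pb : tel_pt b = Some y by rewrite eb tel_seg_pt.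
rewrite /= pa pb /= => /le_lt_trans /(_ ab3); rewrite ltr_pM2l // => xy.
apply: FE; rewrite ea eb; apply: H2; [lra|lra|].
by rewrite /s in xy lev; lra.
Qed.

Lemma tel_end_step : unif_cont_on (@dZ m.+1) (@tel_dist m.+1) setT (telend m.+1).
Proof.
move=> e e0; have e20 : 0 < e / 2 by lra.
have [d1 d10 H1] := endc e20.
have [d2 d20 H2] := (metrizes_unif_continuous (@g m) (dZm m.+1) (dZm m)).1 (@gc m) _ d10.
exists (Num.min d2 (e / 2)); first by rewrite lt_min d20.
move=> x y _ _; rewrite lt_min => /andP[xy1 xy2].
have i1 : 0 < (1 : R) <= 1 by rewrite ltr01 lexx.
rewrite !tel_end_seg /= /cyl_dist /= !tel_seg_retr !tel_seg_lev ?ler01 ?lexx //.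
rewrite !tel_seg_pt // subrr normr0 addr0 minxx mul1r /=.
have := H1 _ _ I I (H2 _ _ I I xy1).
by lra.
Qed.

End Step.

Lemma tel_metrizes m : metrizes (@tel_dist m) /\
  unif_cont_on (@dZ m) (@tel_dist m) setT (telend m).
Proof.
elim: m => [|m [Vm endc]].
  split; first exact: dZm.
  by move=> e e0; exists e.
split; last exact: tel_end_step.
by apply: metrizesP => [e|E]; [exact: tel_ball_entourage|exact: tel_entourage_sub].
Qed.

End TelCylinder.

(** * Uniform ANRs as retracts of neighborhoods in a collar *)

Section MetricUniformity.
Variables (R : realType) (T : Type) (d : T -> T -> R).

(** The carrier with the uniformity of [d]; the proof is an argument so that the
    structure can be inferred from the type. *)
Definition met_space (dP : pseudometric d) : Type := T.

Variable dP : pseudometric d.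

HB.instance Definition _ := gen_eqMixin (met_space dP).
HB.instance Definition _ := gen_choiceMixin (met_space dP).
HB.instance Definition _ := @isUniform.Build (met_space dP) (pm_ent d)
  (@pm_ent_filter R T d) (@pm_ent_diagonal R T d dP) (@pm_ent_inv R T d dP)
  (@pm_ent_split R T d dP).

Lemma met_space_metrizes : @metrizes R (met_space dP) d.
Proof. by []. Qed.

Lemma met_space_metrizable : (forall x y, d x y = 0 -> x = y) ->
  metrizable R (met_space dP).
Proof.
move=> sep; case: (dP) => d0 dxx ds dt; exists d; split => //.
  by move=> x y; split=> [/sep|->].
rewrite met_space_metrizes; apply/seteqP; split=> E [e e0 eE]; exists e => //.
  by move=> [x y]; exact: eE.
by move=> x y xy; exact: (eE (x, y)).
Qed.

End MetricUniformity.

Section SupDist.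
Variables (R : realType) (S : Type) (s0 : S).

(** The cut-off at 1 makes the sup distance finite on unbounded functions. *)
Definition sup_dist (w w' : S -> R) : R :=
  sup [set Num.min 1 `|w s - w' s| | s in [set: S]].

Lemma sup_dist_ge w w' s : Num.min 1 `|w s - w' s| <= sup_dist w w'.
Proof.
apply: ub_le_sup; last by exists s.
by exists 1 => _ [t _ <-]; rewrite ge_min lexx.
Qed.

Lemma sup_dist_le w w' c : (forall s, Num.min 1 `|w s - w' s| <= c) -> sup_dist w w' <= c.
Proof.
move=> H; apply: ge_sup; first by exists (Num.min 1 `|w s0 - w' s0|), s0.
by move=> _ [s _ <-].
Qed.

Lemma sup_dist_lt w w' e s : e <= 1 -> sup_dist w w' < e -> `|w s - w' s| < e.
Proof.
move=> e1 /(le_lt_trans (sup_dist_ge w w' s)); rewrite gt_min => /orP[|//].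
by rewrite ltNge e1.
Qed.

Lemma sup_dist_pm : pseudometric sup_dist.
Proof.
have m0 (w w' : S -> R) s : 0 <= Num.min 1 `|w s - w' s| :> R by rewrite le_min ler01 normr_ge0.
split.
- by move=> w w'; apply: le_trans (sup_dist_ge w w' s0).
- move=> w; apply/eqP; rewrite eq_le (le_trans (m0 w w s0) (sup_dist_ge _ _ _)) andbT.
  by apply: sup_dist_le => s; rewrite subrr normr0 ge_min lexx orbT.
- by move=> w w'; rewrite /sup_dist; congr sup; apply/seteqP; split=> _ [s _ <-];
    exists s => //; rewrite distrC.
- move=> w w' w''; apply: sup_dist_le => s.
  have := sup_dist_ge w w' s; have := sup_dist_ge w' w'' s.
  have := ler_distD (w' s) (w s) (w'' s).
  have := normr_ge0 (w s - w' s); have := normr_ge0 (w' s - w'' s).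
  rewrite !minEle; do 3 case: ifPn; rewrite -?ltNge; lra.
Qed.

Lemma sup_dist_sep w w' : sup_dist w w' = 0 -> w = w'.
Proof.
move=> h; apply/funext => s; apply/eqP; rewrite -subr_eq0 -normr_le0.
have := sup_dist_ge w w' s; rewrite h ge_min => /orP[|//].
by rewrite leNgt ltr01.
Qed.

End SupDist.

Section CollarSpace.
Variables (R : realType) (P : uniformType) (d : P -> P -> R).
Hypothesis dP : pseudometric d.
Hypothesis d1 : forall x y, d x y <= 1.
Hypothesis dm : metrizes d.
Hypothesis dsep : forall x y, d x y = 0 -> x = y.

Definition collar_type : Type := {w : option P -> R | collar d w}.

Definition collar_dist (w w' : collar_type) : R := sup_dist (sval w) (sval w').

Lemma collar_dist_pm : pseudometric collar_dist.
Proof.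
have [h1 h2 h3 h4] := @sup_dist_pm R _ (None : option P).
by split=> [w w'|w|w w'|w w' w'']; [exact: h1|exact: h2|exact: h3|exact: h4].
Qed.

Lemma collar_type_eq (w w' : collar_type) : sval w = sval w' -> w = w'.
Proof.
case: w w' => [w cw] [w' cw'] /= e; subst w'.
by rewrite (Prop_irrelevance cw cw').
Qed.

Lemma collar_dist_sep w w' : collar_dist w w' = 0 -> w = w'.
Proof. by move/sup_dist_sep; exact: collar_type_eq. Qed.

Definition collar_space : uniformType := met_space collar_dist_pm.

Lemma collar_kuratowski y : collar d (kuratowski d y).
Proof. by move=> _; exists y. Qed.

Definition collar_emb (y : P) : collar_space := exist _ _ (@collar_kuratowski y).

Lemma collar_emb_lt y y' e : 0 < e -> d y y' < e -> collar_dist (collar_emb y) (collar_emb y') < e.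
Proof.
move=> e0; apply: le_lt_trans; apply: sup_dist_le; first exact: None.
move=> s; rewrite ge_min; apply/orP; right; case: s => [p|] /=; first exact: dist_lip.
by rewrite subrr normr0; case: dP.
Qed.

Lemma collar_emb_embedding : unif_embedding collar_emb.
Proof.
case: (dP) => d0 dxx ds dt.
have lt y y' e : e <= 1 -> collar_dist (collar_emb y) (collar_emb y') < e -> d y y' < e.
  move=> e1 /(sup_dist_lt (Some y') e1) /=.
  by rewrite dxx subr0 ger0_norm.
split.
- move=> y y' /(congr1 (fun w => sval w (Some y'))) /=.
  by rewrite dxx; exact: dsep.
- apply/(metrizes_unif_continuous _ dm (met_space_metrizes collar_dist_pm)).
  by move=> e e0; exists e => // x y _ _; exact: collar_emb_lt.
- move=> E /(metrizes_sub dm)[e e0 eE].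
  exists [set ww | collar_dist ww.1 ww.2 < Num.min e 1].
    by apply: (metrizes_ball (met_space_metrizes collar_dist_pm)); rewrite lt_min e0 ltr01.
  move=> x y /= h; apply: eE.
  have /lt : Num.min e 1 <= 1 by rewrite ge_min lexx orbT.
  by move=> /(_ _ _ h) /lt_le_trans; apply; rewrite ge_min lexx.
Qed.

(** The collar coordinate vanishes on the closure of the image, and only the
    image has coordinate 0. *)
Lemma collar_emb_closed : closed (range collar_emb).
Proof.
move=> w wcl.
have w0 : sval w None = 0.
  apply/eqP; rewrite -normr_le0 leNgt; apply/negP => wn.
  pose e := Num.min 1 `|sval w None|.
  have e0 : 0 < e by rewrite lt_min ltr01.
  have [|_ [[y _ <-] /xsectionP h]] := wcl (xsection [set ww | collar_dist ww.1 ww.2 < e] w).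
    apply: nbhs_entourage; exact: (metrizes_ball (met_space_metrizes collar_dist_pm)).
  have e1 : e <= 1 by rewrite ge_min lexx.
  have := sup_dist_lt None e1 h; rewrite /= subr0 /e lt_min => /andP[_].
  by rewrite ltxx.
have [y wy] := svalP w w0.
by exists y => //; exact/esym/collar_type_eq.
Qed.

Lemma collar_space_retraction (N : set collar_space) : unif_retract N (range collar_emb) ->
  (exists w, N w) -> (forall y, N (collar_emb y)) ->
  exists r, collar_retraction d [set w | exists h : collar d w, N (exist _ w h)] r.
Proof.
move=> [r [rc rr rK]] [w0 Nw0] Ni.
have [p0 _ _] := rr (SigSub (mem_set Nw0)).
have rP (w : {w | exists h : collar d w, N (exist _ w h)}) : exists y, exists h : collar d (sval w),
    exists Nh : N (exist _ (sval w) h), r (SigSub (mem_set Nh)) = collar_emb y.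
  case: w => w [h Nh] /=; have [y _ yE] := rr (SigSub (mem_set Nh)).
  by exists y, h, Nh.
pose q w := if pselect (exists h : collar d w, N (exist _ w h)) is left h
  then sval (cid (rP (exist _ w h))) else p0.
have qP w (h : collar d w) (Nh : N (exist _ w h)) : collar_emb (q w) = r (SigSub (mem_set Nh)).
  rewrite /q; case: pselect => [H|]; last by case; exists h.
  case: cid => y /= [h' [Nh' <-]].
  have E : h' = h by exact: Prop_irrelevance.
  by subst h'; rewrite (Prop_irrelevance Nh' Nh).
exists q; split.
- move=> y; have [ij _ _] := collar_emb_embedding; apply: ij.
  rewrite (qP _ (@collar_kuratowski y) (Ni y)) rK //.
- move=> e e0; have [_ _ ic] := collar_emb_embedding.
  have [F eF FE] := ic _ (metrizes_ball dm e0).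
  have [V eV VF] := rc _ eF.
  have [a a0 aV] := metrizes_sub (met_space_metrizes collar_dist_pm) eV.
  exists (a / 2); first by lra.
  move=> w w' _ _ [h Nh] [h' Nh'] ww; apply: (FE (q w) (q w')).
  rewrite (qP _ _ Nh) (qP _ _ Nh').
  apply: (VF (SigSub (mem_set Nh), SigSub (mem_set Nh'))) => /=.
  apply: (aV (exist _ w h) (exist _ w' h')).
  apply: (@le_lt_trans _ _ (a / 2)); last lra.
  apply: sup_dist_le; first exact: None.
  by move=> s /=; rewrite ge_min; apply/orP; right; exact: ltW.
Qed.

Lemma collar_retraction_sub (N N' : set (option P -> R)) r :
  (forall w, collar d w -> N' w -> N w) ->
  collar_retraction d N r -> collar_retraction d N' r.
Proof.
move=> NN [rK rc]; split=> // e /rc[del del0 H]; exists del => // w w' cw cw' Nw Nw'.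
by apply: H => //; exact: NN.
Qed.

Lemma uniform_AR_retraction : uniform_AR R P -> exists r, collar_retraction d setT r.
Proof.
move=> [_ /(_ collar_space collar_emb)].
move=> /(_ (met_space_metrizable _ collar_dist_sep) collar_emb_embedding collar_emb_closed).
move=> /collar_space_retraction[|//|r rP].
  have h : collar d (fun=> 1) by move=> /eqP; rewrite oner_eq0.
  by exists (exist _ _ h).
by exists r; apply: collar_retraction_sub rP => w cw _; exists cw.
Qed.

Lemma uniform_ANR_retraction : uniform_ANR R P -> inhabited P ->
  exists2 e, 0 < e & exists r, collar_retraction d (near_kuratowski d e) r.
Proof.
move=> [_ /(_ collar_space collar_emb)].
move=> /(_ (met_space_metrizable _ collar_dist_sep) collar_emb_embedding collar_emb_closed).
move=> [N [E /(metrizes_sub (met_space_metrizes collar_dist_pm))[e e0 eE] EN] Nr] [p0].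
have Ni y : N (collar_emb y).
  by apply: (EN (collar_emb y)); [exists y|apply: eE; case: collar_dist_pm => _ ->].
have [|//|r rP] := collar_space_retraction Nr; first by exists (collar_emb p0).
exists (e / 2); first by lra.
exists r; apply: collar_retraction_sub rP => w cw [y wy]; exists cw.
apply: (EN (collar_emb y)); first by exists y.
apply: eE; apply: (@le_lt_trans _ _ (e / 2)); last lra.
apply: sup_dist_le; first exact: None.
by move=> s; rewrite ge_min distrC; apply/orP; right; exact: ltW.
Qed.

Lemma uniform_AR_absolute_extensor : uniform_AR R P -> absolute_extensor d.
Proof. by move=> /uniform_AR_retraction[r]; exact: retract_absolute_extensor. Qed.

Lemma uniform_ANR_cone_extensor : uniform_ANR R P -> inhabited P -> cone_extensor d.
Proof.
move=> h1 h2; have [e e0 [r rP]] := uniform_ANR_retraction h1 h2.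
exact: (retract_cone_extensor dP d1 e0 rP).
Qed.

End CollarSpace.

(** * Limits and extended telescopes *)

Section LimitMetric.
Variables (R : realType) (X : nat -> uniformType) (p : forall n, X n.+1 -> X n).
Variable d : forall n, X n -> X n -> R.
Hypothesis dP : forall n, pseudometric (@d n).

Definition dyadic (n : nat) : R := 2^-1 ^+ n.

Lemma dyadic_gt0 n : 0 < dyadic n.
Proof. by rewrite exprn_gt0 // invr_gt0. Qed.

Lemma dyadicS n : dyadic n = 2 * dyadic n.+1.
Proof. by rewrite /dyadic exprS mulrA divff ?mul1r. Qed.

Lemma dyadic_le m n : (m <= n)%N -> dyadic n <= dyadic m.
Proof. by move=> mn; apply: ler_wiXn2l => //; rewrite ?invr_ge0 // invf_le1 // ler1n. Qed.

Lemma ex_dyadic_lt e : 0 < e -> exists n, dyadic n < e.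
Proof.
move=> e0; exists (Num.truncn e^-1).+1; set n := _.+1.
have en : e^-1 < n%:R by exact: truncnS_gt.
have n0 : 0 < n%:R :> R by rewrite ltr0n.
rewrite /dyadic exprVn -[ltRHS]invrK ltf_pV2 ?posrE ?exprn_gt0 ?invr_gt0 //.
by apply: (lt_trans en); rewrite -natrX ltr_nat ltn_expl.
Qed.

(** A supremum instead of a series: the [n]-th term is at most [2^-n], so that
    only finitely many terms matter at a given scale. *)
Definition invlim_dist (x y : invlim p) : R :=
  sup [set Num.min (dyadic n) (d (invlim_proj n x) (invlim_proj n y)) | n in [set: nat]].

Lemma invlim_dist_ge x y n :
  Num.min (dyadic n) (d (invlim_proj n x) (invlim_proj n y)) <= invlim_dist x y.
Proof.
apply: ub_le_sup; last by exists n.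
exists 1 => _ [m _ <-]; rewrite ge_min; apply/orP; left.
by rewrite -[1]/(dyadic 0); exact: dyadic_le.
Qed.

Lemma invlim_dist_le x y c :
  (forall n, Num.min (dyadic n) (d (invlim_proj n x) (invlim_proj n y)) <= c) ->
  invlim_dist x y <= c.
Proof.
move=> H; apply: ge_sup; last by move=> _ [n _ <-].
by exists (Num.min (dyadic 0) (d (invlim_proj 0 x) (invlim_proj 0 y))), 0.
Qed.

Lemma invlim_dist_pm : pseudometric invlim_dist.
Proof.
have m0 n (x y : X n) : 0 <= Num.min (dyadic n) (d x y).
  by rewrite le_min ltW ?dyadic_gt0 //; case: (dP n) => ->.
split.
- by move=> x y; apply: le_trans (invlim_dist_ge x y 0).
- move=> x; apply/eqP; rewrite eq_le (le_trans (m0 0 _ _) (invlim_dist_ge x x 0)) andbT.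
  by apply: invlim_dist_le => n; rewrite ge_min; case: (dP n) => _ -> _ _; rewrite lexx orbT.
- move=> x y; rewrite /invlim_dist; congr sup; apply/seteqP; split=> _ [n _ <-];
    exists n => //; by case: (dP n) => _ _ -> _.
- move=> x y z; apply: invlim_dist_le => n.
  have := invlim_dist_ge x y n; have := invlim_dist_ge y z n.
  case: (dP n) => d0 _ _ dt; have := dt (invlim_proj n x) (invlim_proj n y) (invlim_proj n z).
  have := d0 (invlim_proj n x) (invlim_proj n y); have := d0 (invlim_proj n y) (invlim_proj n z).
  have := dyadic_gt0 n.
  rewrite !minEle; do 3 case: ifPn; rewrite -?ltNge; lra.
Qed.

Lemma invlim_dist_proj n e : 0 < e -> exists2 del, 0 < del & forall x y,
  invlim_dist x y < del -> d (invlim_proj n x) (invlim_proj n y) < e.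
Proof.
move=> e0; exists (Num.min (dyadic n) e); first by rewrite lt_min dyadic_gt0.
move=> x y /(le_lt_trans (invlim_dist_ge x y n)).
by rewrite lt_min !gt_min ltxx /= => /andP[h /orP[/(lt_trans h)|]].
Qed.

Lemma invlim_dist_small e : 0 < e -> exists N, forall x y,
  (forall n, (n < N)%N -> d (invlim_proj n x) (invlim_proj n y) < e / 2) ->
  invlim_dist x y < e.
Proof.
move=> e0; have e20 : 0 < e / 2 by lra.
have [N hN] := ex_dyadic_lt e20; exists N.+1 => // x y H.
apply: (@le_lt_trans _ _ (e / 2)); last lra.
apply: invlim_dist_le => n; rewrite ge_min; have [nN|nN] := ltnP n N.+1.
  by rewrite (ltW (H n nN)) orbT.
by rewrite (le_trans (dyadic_le (ltnW nN)) (ltW hN)).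
Qed.

Lemma invlim_metrizes : (forall n, metrizes (@d n)) -> metrizes invlim_dist.
Proof.
move=> dm; apply: metrizesP => [e e0|E eE].
  have [N H] := invlim_dist_small e0; have e20 : 0 < e / 2 by lra.
  suff : entourage [set xy : invlim p * invlim p | forall n, (n < N)%N ->
      d (invlim_proj n xy.1) (invlim_proj n xy.2) < e / 2].
    by apply: filterS => -[x y] /H.
  elim: N {H} => [|N IH]; first by apply: filterS filterT => xy _ n.
  apply: filterS (filterI IH (invlim_ent_proj p (metrizes_ball (dm N) e20))).
  move=> xy [h1 h2] n; rewrite ltnS leq_eqVlt => /predU1P[->|/h1//].
  exact: h2.
apply: (invlim_ent_sub (@pm_ent_filter _ _ invlim_dist)) eE => n F.
move=> /(metrizes_sub (dm n))[e e0 eF].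
have [del del0 H] := invlim_dist_proj n e0.
by exists del => // x y /H /eF.
Qed.

Lemma invlim_unif_cont (T : Type) (dT : T -> T -> R) (S : set T) (w : T -> invlim p) :
  (forall n, unif_cont_on dT (@d n) S (fun x => invlim_proj n (w x))) ->
  unif_cont_on dT invlim_dist S w.
Proof.
move=> wc e e0; have [N H] := invlim_dist_small e0; have e20 : 0 < e / 2 by lra.
suff [del del0 K] : exists2 del, 0 < del & forall x y, S x -> S y -> dT x y < del ->
    forall n, (n < N)%N -> d (invlim_proj n (w x)) (invlim_proj n (w y)) < e / 2.
  by exists del => // x y Sx Sy xy; apply: H => n nN; exact: (K _ _ Sx Sy xy).
elim: N {H} => [|N [d1 d10 IH]]; first by exists 1.
have [d2 d20 H2] := wc N _ e20.
exists (Num.min d1 d2); first by rewrite lt_min d10.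
move=> x y Sx Sy; rewrite lt_min => /andP[xy1 xy2] n.
by rewrite ltnS leq_eqVlt => /predU1P[->|/IH]; [exact: H2|apply].
Qed.

(** A sequence that is a thread from the index [m] on determines a point of the
    limit: correct its first terms one by one, downwards. *)
Lemma invlim_eventual_thread (m : nat) (z : forall n, X n) :
  (forall n, (m <= n)%N -> p (z n.+1) = z n) ->
  exists w : invlim p, forall n, (m <= n)%N -> invlim_proj n w = z n.
Proof.
elim: m z => [|m IH] z zP.
  by exists (@invlim_mk _ p z (fun n => zP n (leq0n n))).
have [|w wP] := IH (eqtype.dfwith (T := X) z (i := m) (p (z m.+1))).
  move=> n; rewrite leq_eqVlt => /predU1P[<-|mn].
    by rewrite eqtype.dfwith_in eqtype.dfwith_out // ltn_eqF.
  by rewrite !eqtype.dfwith_out ?zP // ltn_eqF // ltnW.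
exists w => n mn; rewrite wP ?(ltnW mn) // eqtype.dfwith_out //.
by rewrite ltn_eqF.
Qed.

End LimitMetric.

Section ExtendedTelescope.
Variables (R : realType) (Z : nat -> uniformType) (g : forall n, Z n.+1 -> Z n).
Local Notation tel := (tel R g).
Local Notation telend m := (@tel_end R Z m (Defs.telescope R g m)).
Variable dZ : forall n, Z n -> Z n -> R.
Hypothesis dZP : forall n, pseudometric (@dZ n).
Hypothesis dZ1 : forall n x y, @dZ n x y <= 1.
Hypothesis dZm : forall n, metrizes (@dZ n).
Hypothesis dZs : forall n x y, @dZ n x y = 0 -> x = y.
Hypothesis gc : forall n, unif_continuous (@g n).

Local Notation TD := (tel_dist (R := R) (g := g) dZ).
Definition tel_ext_dist : tel_ext R g -> tel_ext R g -> R := invlim_dist (fun m => @TD m).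

Let TDP m : pseudometric (@TD m) := tel_dist_pm g dZP dZ1 m.

Lemma tel_ext_dist_pm : pseudometric tel_ext_dist.
Proof. exact: invlim_dist_pm. Qed.

Lemma tel_ext_metrizes : metrizes tel_ext_dist.
Proof.
by apply: invlim_metrizes => // n; have [] := tel_metrizes dZP dZ1 dZm gc n.
Qed.

Lemma tel_end_dist_ge m x y : dZ x y <= @TD m (telend m x) (telend m y).
Proof.
case: m x y => [//|m] x y; rewrite !tel_end_seg.
have i1 : 0 < (1 : R) <= 1 by rewrite ltr01 lexx.
have := @cyl_pt_lip R _ _ _ _ (tel_cyl R g m) (@TD m) (@dZ m.+1) (TDP m) (dZP m.+1) (@dZ1 m.+1) 1
  (tel_seg g x 1) (tel_seg g y 1).
by rewrite /= !tel_seg_lev ?ler01 ?lexx // !tel_seg_pt //= mul1r; apply.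
Qed.

Lemma tel_inf_dist_ge (x y : invlim g) :
  invlim_dist dZ x y <= tel_ext_dist (tel_inf R x) (tel_inf R y).
Proof.
apply: invlim_dist_le => n; apply: le_trans (invlim_dist_ge _ _ _ n).
by rewrite le_min !ge_min lexx tel_end_dist_ge orbT.
Qed.

Lemma tel_inf_unif_cont : unif_cont_on (invlim_dist dZ) tel_ext_dist setT (tel_inf R (g := g)).
Proof.
apply: invlim_unif_cont => n e e0.
have [_ /(_ e e0)[d1 d10 H1]] := tel_metrizes dZP dZ1 dZm gc n.
have [del del0 H] := invlim_dist_proj g dZ n d10.
by exists del => // x y _ _ /H xy; exact: H1.
Qed.

Lemma tel_inf_of_levels (x : tel_ext R g) :
  (forall m, tel_lev (invlim_proj m.+1 x) = 1) -> range (tel_inf R (g := g)) x.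
Proof.
move=> lx.
have ex m : exists z, invlim_proj m x = telend m z.
  case: m => [|m]; first by exists (invlim_proj 0 x).
  case: (tel_cases (invlim_proj m.+1 x)) => [xE|[z _ xE]].
    by have := lx m; rewrite xE tel_lev_inl => /esym/eqP; rewrite oner_eq0.
  by exists z; rewrite tel_end_seg xE lx.
pose z m := sval (cid (ex m)).
have zP m : invlim_proj m x = telend m (z m) := svalP (cid (ex m)).
have zg n : g (z n.+1) = z n.
  by apply: (@tel_end_inj R Z g n); rewrite -tel_retr_end -!zP invlim_projP.
exists (invlim_mk zg) => //; apply: val_inj.
by apply: functional_extensionality_dep => n; exact/esym/zP.
Qed.

(** The part of the telescope over oo is closed, since its points are those of level
    1 in every cylinder; so it is the zero set of the distance to it. *)
Lemma ex_end_function : exists b : tel_ext R g -> R,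
  [/\ forall x, 0 <= b x, unif_cont_on tel_ext_dist rdist setT b
    & forall x, b x = 0 <-> range (tel_inf R (g := g)) x].
Proof.
have [b [b0 bB bl ba]] := dist_fun (range (tel_inf R (g := g))) tel_ext_dist_pm.
exists b; split => //.
  by move=> e e0; exists e => // x y _ _; apply: le_lt_trans; exact: bl.
move=> x; split=> [bx|/bB//]; apply: tel_inf_of_levels => m.
apply/eqP; rewrite eq_le; have /andP[_ ->] /= := cyl_lev01 (tel_cyl R g m) (invlim_proj m.+1 x).
rewrite leNgt; apply/negP => l1.
have l0 : 0 < 1 - tel_lev (invlim_proj m.+1 x) by lra.
have [del del0 H] := invlim_dist_proj (tel_retr (g := g)) (fun m => @TD m) m.+1 l0.
have [||_ [z _ <-]] := ba x (Num.min del 1).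
- by rewrite bx lt_min del0 ltr01.
- by rewrite ge_min lexx orbT.
rewrite lt_min => /andP[/H xz _].
have := le_lt_trans (cyl_lev_lip (tel_cyl R g m) (TDP m) (dZP m.+1) (@dZ1 m.+1) _ _) xz.
rewrite /= -[invlim_proj m.+1 (tel_inf _ _)]/(telend m.+1 (invlim_proj m.+1 z)) tel_end_seg.
rewrite tel_seg_lev ?ler01 ?lexx // => /lt_dist[_].
by rewrite ltxx.
Qed.

Hypothesis Z0ae : absolute_extensor (@dZ 0).
Hypothesis Zce : forall n, inhabited (Z n) -> cone_extensor (@dZ n).

Lemma tel_glue_unif_cont m :
  unif_cont_on (@dZ m.+1) (@TD m) setT (telend m \o @g m).
Proof.
move=> e /(tel_metrizes dZP dZ1 dZm gc m).2[d1 d10 H1].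
have [d2 d20 H2] := (metrizes_unif_continuous (@g m) (dZm m.+1) (dZm m)).1 (@gc m) _ d10.
by exists d2 => // x y _ _ xy; apply: H1 => //; exact: H2.
Qed.

Lemma tel_absolute_extensor m : absolute_extensor (@TD m).
Proof.
elim: m => [|m IH]; first exact: Z0ae.
apply: (cyl_absolute_extensor (C := tel_cyl R g m) (TDP m) (dZP m.+1) (@dZ1 m.+1)) => //.
- exact: tel_dist_sep.
- exact: tel_glue_unif_cont.
- exact: Zce.
Qed.

(** Lift stage by stage, with [cyl_lift] at closeness [2^-m] and with change
    confined to [b < 2^-m].  Off the zero set the stages are eventually carried
    along by the inclusions, so that they form a thread from some index on and the
    level in the later cylinders is 0; in particular the limit point is not over
    oo.  The retractions are 1-Lipschitz, hence the limit is uniformly within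
    [2 * 2^-n] of the [n]-th stage and is uniformly continuous. *)
Lemma tel_ext_extension (T : Type) (d : T -> T -> R) (b : T -> R) (f : T -> tel_ext R g) :
  pseudometric d -> (forall x, 0 <= b x) -> unif_cont_on d rdist setT b ->
  unif_cont_on d tel_ext_dist [set x | b x = 0] f ->
  exists h : T -> tel_ext R g,
  [/\ unif_cont_on d tel_ext_dist setT h, forall x, b x = 0 -> h x = f x
    & forall x, b x <> 0 -> tel_fin (h x)].
Proof.
move=> dd b0 bc fc.
have fmc m : unif_cont_on d (@TD m) [set x | b x = 0] (fun x => invlim_proj m (f x)).
  move=> e e0; have [d1 d10 H1] := invlim_dist_proj (tel_retr (g := g)) (fun m => @TD m) m e0.
  have [del del0 H] := fc _ d10; exists del => // x y bx b_y xy.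
  by apply: H1; exact: H.
pose ok m (s : T -> tel m) := unif_cont_on d (@TD m) setT s /\
  forall x, b x = 0 -> s x = invlim_proj m (f x).
pose next m (s : T -> tel m) (s' : T -> tel m.+1) :=
  (forall x, @TD m (tel_retr (s' x)) (s x) < dyadic R m) /\
  (forall x, dyadic R m <= b x -> s' x = cyl_base (tel_cyl R g m) (s x)).
have step m (s : {s | ok m s}) : exists s' : {s' | ok m.+1 s'}, next m (sval s) (sval s').
  case: s => s [sc sf].
  have [|s' [sc' sf' sr sb]] := cyl_lift (C := tel_cyl R g m) (TDP m) (dZP m.+1) (@dZ1 m.+1)
    (tel_dist_sep dZP dZ1 dZs (m := m)) (@tel_glue_unif_cont m) (@tel_absolute_extensor m)
    (@Zce m.+1) dd b0 bc (fmc m.+1) sc _ (dyadic_gt0 R m) (dyadic_gt0 R m).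
  - by move=> x bx; rewrite sf // /= invlim_projP.
  - by exists (exist _ s' (conj sc' sf')).
have [s0 s0P] : exists s, ok 0 s.
  by have [s sc sf] := tel_absolute_extensor dd b0 bc (fmc 0); exists s.
(* The stages, each lifting the preceding one. *)
pose st := fix st m : {s | ok m s} :=
  if m is k.+1 then sval (cid (step k (st k))) else exist _ s0 s0P.
pose s m := sval (st m).
have sok m : ok m (s m) := svalP (st m).
have snext m : next m (s m) (s m.+1) := svalP (cid (step m (st m))).
have thr x : exists w : tel_ext R g,
    (b x = 0 -> w = f x) /\
    (b x <> 0 -> exists m, (dyadic R m <= b x) /\
       forall n, (m <= n)%N -> invlim_proj n w = s n x).
  have [bx|bx] := pselect (b x = 0); first by exists (f x).
  have bp : 0 < b x by rewrite lt_neqAle b0 andbT eq_sym; apply/eqP.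
  have [m hm] := ex_dyadic_lt bp.
  have [|w wP] := @invlim_eventual_thread _ (tel_retr (g := g)) m (fun n => s n x).
    move=> n mn; rewrite (snext n).2; last exact: le_trans (dyadic_le R mn) (ltW hm).
    exact: tel_retr_inl.
  exists w; split => // _; exists m; split => //; exact: ltW.
have [h hP] := boolp.choice thr.
have hb x : b x = 0 -> h x = f x by exact: (hP x).1.
(* Downward induction from the index at which the thread is reached. *)
have near x n : @TD n (invlim_proj n (h x)) (s n x) <= 2 * dyadic R n.
  have n0 k : 0 <= 2 * dyadic R k by rewrite mulr_ge0 // ltW // dyadic_gt0.
  have [bx|bx] := pselect (b x = 0).
    by rewrite hb // (sok n).2 //; case: (TDP n) => _ -> _ _.
  have [m [_ mP]] := (hP x).2 bx.
  have : (m <= n + (m - n))%N by rewrite -leq_subLR.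
  move: (m - n)%N => k; elim: k n => [|k IH] n.
    by rewrite addn0 => mn; rewrite mP //; case: (TDP n) => _ -> _ _.
  rewrite addnS -addSn => /IH hn.
  have h1 := cyl_retr_lip (tel_cyl R g n) (@TD n) (dZP n.+1) (@dZ1 n.+1)
    (invlim_proj n.+1 (h x)) (s n.+1 x).
  have h2 := (snext n).1 x; have [_ _ _ dt] := TDP n.
  have := dt (invlim_proj n (h x)) (tel_retr (s n.+1 x)) (s n x).
  rewrite /= invlim_projP in h1; rewrite dyadicS in h2 *.
  by move: hn h1 h2 => /=; lra.
have lip x y n k : @TD n (invlim_proj n (h x)) (invlim_proj n (h y)) <=
    @TD (k + n) (invlim_proj (k + n) (h x)) (invlim_proj (k + n) (h y)).
  elim: k => [|k IH]; first exact: lexx.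
  apply: (le_trans IH).
  have := cyl_retr_lip (tel_cyl R g (k + n)) (@TD (k + n)) (dZP (k + n).+1) (@dZ1 (k + n).+1)
    (invlim_proj (k + n).+1 (h x)) (invlim_proj (k + n).+1 (h y)).
  by rewrite /= !invlim_projP.
exists h; split => //.
  apply: invlim_unif_cont => n e e0; have e60 : 0 < e / 6 by lra.
  have e30 : 0 < e / 3 by lra.
  have [k hk] := ex_dyadic_lt e60.
  have [del del0 H] := (sok (k + n)%N).1 _ e30.
  exists del => // x y _ _ xy.
  apply: (le_lt_trans (lip x y n k)).
  have hkn : dyadic R (k + n) <= dyadic R k by apply: dyadic_le; exact: leq_addr.
  have := near x (k + n)%N; have := near y (k + n)%N; have := H _ _ I I xy.
  have [_ _ ds dt] := TDP (k + n).
  have := dt (invlim_proj (k + n) (h x)) (s (k + n)%N x) (invlim_proj (k + n) (h y)).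
  have := dt (s (k + n)%N x) (s (k + n)%N y) (invlim_proj (k + n) (h y)).
  by rewrite (ds (s (k + n)%N y)); lra.
move=> x bx; rewrite tel_finE => -[z _ zx].
have [m [hm mP]] := (hP x).2 bx.
have := mP m.+1 (leqnSn m); rewrite -zx (snext m).2 //.
move=> /(congr1 (@tel_lev R Z g m)).
rewrite -[invlim_proj m.+1 _]/(telend m.+1 (invlim_proj m.+1 z)) tel_end_seg.
rewrite tel_seg_lev ?ler01 ?lexx // tel_lev_inl => /eqP; by rewrite oner_eq0.
Qed.

End ExtendedTelescope.

(** * Extension of maps and homotopies over the extended telescopes *)

Section Extensions.
Variables (R : realType) (X Y : nat -> uniformType).
Variables (p : forall n, X n.+1 -> X n) (q : forall n, Y n.+1 -> Y n).
Variables (dX : forall n, X n -> X n -> R) (dY : forall n, Y n -> Y n -> R).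
Hypothesis dXP : forall n, pseudometric (@dX n).
Hypothesis dX1 : forall n x y, @dX n x y <= 1.
Hypothesis dXm : forall n, metrizes (@dX n).
Hypothesis pc : forall n, unif_continuous (@p n).
Hypothesis dYP : forall n, pseudometric (@dY n).
Hypothesis dY1 : forall n x y, @dY n x y <= 1.
Hypothesis dYm : forall n, metrizes (@dY n).
Hypothesis dYs : forall n x y, @dY n x y = 0 -> x = y.
Hypothesis qc : forall n, unif_continuous (@q n).
Hypothesis Y0ae : absolute_extensor (@dY 0).
Hypothesis Yce : forall n, inhabited (Y n) -> cone_extensor (@dY n).
Variable y0 : Y 0%N.
Variable f : invlim p -> invlim q.
Hypothesis fc : unif_continuous f.

Local Notation DX := (tel_ext_dist (R := R) (g := p) dX).
Local Notation DY := (tel_ext_dist (R := R) (g := q) dY).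
Local Notation X_inf := (tel_inf R (g := p)).
Local Notation Y_inf := (tel_inf R (g := q)).

Lemma tel_ext_inhabited : inhabited (tel_ext R q).
Proof.
pose s := fix s m : tel R q m :=
  if m is k.+1 return tel R q m then cyl_base (tel_cyl R q k) (s k) else y0.
by constructor; exists s; apply/mem_set => n; exact: tel_retr_inl.
Qed.

Let fD : unif_cont_on (invlim_dist dX) (invlim_dist dY) setT f.
Proof.
by apply: (iffLR (metrizes_unif_continuous f _ _) fc); exact: invlim_metrizes.
Qed.

Let unif_cont_ext F : unif_continuous F <-> unif_cont_on DX DY setT F.
Proof. by apply: metrizes_unif_continuous; exact: tel_ext_metrizes. Qed.

Lemma tel_inf_inj : injective X_inf.
Proof.
move=> x x' e; apply: val_inj; apply: functional_extensionality_dep => n.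
by apply: (@tel_end_inj R X p n); have := congr1 (invlim_proj n) e.
Qed.

Lemma ex_telescope_extension : exists F : tel_ext R p -> tel_ext R q, telescope_extension f F.
Proof.
have [b [b0 bc bE]] := ex_end_function p dXP dX1.
have [j] := tel_ext_inhabited.
pose phi x := if pselect (exists z, X_inf z = x) is left h then Y_inf (f (sval (cid h))) else j.
have phiE z : phi (X_inf z) = Y_inf (f z).
  rewrite /phi; case: pselect => [h|]; last by case; exists z.
  by case: cid => z' /= /tel_inf_inj ->.
have [|F [Fc FE Ffin]] := tel_ext_extension dYP dY1 dYm dYs qc Y0ae Yce
    (tel_ext_dist_pm p dXP dX1) b0 bc (f := phi).
  move=> e e0; have [d1 d10 H1] := tel_inf_unif_cont dYP dY1 dYm qc e0.
  have [d2 d20 H2] := fD d10.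
  exists d2 => // x x' /bE[z _ <-] /bE[z' _ <-] xx; rewrite !phiE.
  apply: H1 => //; apply: H2 => //.
  by apply: le_lt_trans xx; exact: tel_inf_dist_ge.
exists F; split.
- exact/unif_cont_ext.
- by move=> x; rewrite FE ?phiE //; apply/bE; exists x.
- by move=> x; rewrite tel_finE => xN; apply: Ffin => /bE.
Qed.

(** The map [phi] on the zero set of [c], which is the union of the part over oo
    and of the two ends, is uniformly continuous although its definition jumps at
    [t = 1]: points of the zero set near that end either lie on it or lie over oo,
    where [F] and [G] agree. *)
Lemma telescope_extensions_homotopic (F G : tel_ext R p -> tel_ext R q) : telescope_extension f F -> telescope_extension f G ->
  unif_homotopic_extensions f F G.
Proof.
move=> [/unif_cont_ext Fc Ff Ffin] [/unif_cont_ext Gc Gf Gfin].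
have [b [b0 bc bE]] := ex_end_function p dXP dX1.
have DP := prod_dist_pm (tel_ext_dist_pm p dXP dX1) (ui_dist_pm R).
have DXP := tel_ext_dist_pm p dXP dX1.
have DYP := tel_ext_dist_pm q dYP dY1.
have DX0 x x' : 0 <= DX x x' by case: DXP.
have t01 (t : unit_interval R) : 0 <= ui_val t <= 1 by exact: (set_valP t).
pose c (xt : tel_ext R p * unit_interval R) :=
  Num.min (b xt.1) (Num.min (ui_val xt.2) (1 - ui_val xt.2)).
pose phi (xt : tel_ext R p * unit_interval R) := if ui_val xt.2 == 1 then G xt.1 else F xt.1.
have c0 xt : 0 <= c xt.
  by rewrite /c !le_min b0 /=; have /andP[? ?] := t01 xt.2; apply/andP; split; lra.
have cE xt : c xt = 0 -> [\/ b xt.1 = 0, ui_val xt.2 = 0 | ui_val xt.2 = 1].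
  rewrite /c minEle; case: ifPn => _; first by constructor 1.
  by rewrite minEle; case: ifPn => _ ?; [constructor 2|constructor 3; lra].
have cE' xt : [\/ b xt.1 = 0, ui_val xt.2 = 0 | ui_val xt.2 = 1] -> c xt = 0.
  move=> h; apply/eqP; rewrite eq_le c0 andbT /c !ge_min.
  by case: h => ->; rewrite ?subrr ?lexx ?orbT.
have FG x : b x = 0 -> F x = G x by move=> /bE[z _ <-]; rewrite Ff Gf.
have [||H [Hc HE Hfin]] := tel_ext_extension dYP dY1 dYm dYs qc Y0ae Yce DP c0 _ (f := phi).
- move=> e e0; have [d1 d10 H1] := bc _ e0.
  exists (Num.min d1 e); first by rewrite lt_min d10.
  move=> [x t] [x' t'] _ _; rewrite lt_min /prod_dist /= => /andP[xx1 xx2].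
  have := DX0 x x'; have := normr_ge0 (ui_val t - ui_val t').
  rewrite -/(ui_dist t t') => u0 x0.
  apply: dist_min_lt; last apply: dist_min_lt.
  + by apply: H1 => //; lra.
  + by rewrite -[X in X < _]/(ui_dist t t'); lra.
  + rewrite /= (_ : _ - _ = - (ui_val t - ui_val t')); last by ring.
    by rewrite normrN -[X in X < _]/(ui_dist t t'); lra.
- move=> e e0; have [d1 d10 H1] := Fc _ e0; have [d2 d20 H2] := Gc _ e0.
  exists (Num.min 1 (Num.min d1 d2)); first by rewrite !lt_min ltr01 d10.
  move=> [x t] [x' t'] /= /cE /= ct /cE /= ct'; rewrite !lt_min /prod_dist /=.
  move=> /and3P[xt1 xt2 xt3].
  have x0 := DX0 x x'; have u0 : 0 <= ui_dist t t' by exact: normr_ge0.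
  have /lt_dist[h1 h2] : `|ui_val t - ui_val t'| < 1 by rewrite -[X in X < _]/(ui_dist t t'); lra.
  have FF : DY (F x) (F x') < e by apply: H1 => //; lra.
  have GG : DY (G x) (G x') < e by apply: H2 => //; lra.
  rewrite /phi /=; case: eqP => t1; case: eqP => t1' //.
    by case: ct' => [/FG ->//|?|//]; exfalso; lra.
  by case: ct => [/FG ->//|?|//]; exfalso; lra.
exists H.
have phiF x : phi (x, ui0 R) = F x by rewrite /phi /ui_val /= eq_sym oner_eq0.
have phiG x : phi (x, ui1 R) = G x by rewrite /phi /ui_val /= eqxx.
have HcX : unif_continuous H.
  apply: (iffRL (metrizes_unif_continuous H _ _) Hc); last exact: tel_ext_metrizes.
  by apply: metrizes_prod => //; [exact: ui_dist_pm|exact: tel_ext_metrizes|exact: metrizes_ui].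
split => //.
- by move=> x; rewrite HE ?phiF //; apply: cE'; constructor 2.
- by move=> x; rewrite HE ?phiG //; apply: cE'; constructor 3.
- move=> t; split.
  + apply/unif_cont_ext => e /Hc[del del0 K]; exists del => // x x' _ _ xx.
    by apply: K => //; rewrite /prod_dist /= /ui_dist subrr normr0 addr0.
  + move=> x; rewrite HE; first by rewrite /phi /=; case: ifP; rewrite ?Ff ?Gf.
    by apply: cE'; constructor 1; apply/bE; exists x.
  + move=> x xfin; have [cx|cx] := pselect (c (x, t) = 0); last exact: Hfin.
    by rewrite HE // /phi /=; case: ifP => _; [exact: Gfin|exact: Ffin].
Qed.

End Extensions.

Theorem corollary16p9 (R : realType)
  (Y : nat -> uniformType) (q : forall n, Y n.+1 -> Y n)
  (X : nat -> uniformType) (p : forall n, X n.+1 -> X n)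
  (hY : forall n, uniform_ANR R (Y n))
  (hY0 : uniform_AR R (Y 0%N))
  (hq : forall n, unif_continuous (@q n))
  (hX : forall n, metrizable R (X n))
  (hp : forall n, unif_continuous (@p n))
  (hconv : convergent p)
  (f : invlim p -> invlim q) (hf : unif_continuous f) :
  (exists F : tel_ext R p -> tel_ext R q, telescope_extension f F) /\
  (forall F G : tel_ext R p -> tel_ext R q,
     telescope_extension f F -> telescope_extension f G ->
     unif_homotopic_extensions f F G).
Proof.
pose dX n := sval (cid (metrizable_metrizes (hX n))).
have dXP n : _ := svalP (cid (metrizable_metrizes (hX n))).
pose dY n := sval (cid (metrizable_metrizes (hY n).1)).
have dYP n : _ := svalP (cid (metrizable_metrizes (hY n).1)).
have dX_pm n : pseudometric (dX n) by case: (dXP n).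
have dX_m n : metrizes (dX n) by case: (dXP n).
have dX_1 n x y : dX n x y <= 1 by case: (dXP n) => _ _ _; apply.
have dY_pm n : pseudometric (dY n) by case: (dYP n).
have dY_m n : metrizes (dY n) by case: (dYP n).
have dY_s n x y : dY n x y = 0 -> x = y by case: (dYP n) => _ _ + _; apply.
have dY_1 n x y : dY n x y <= 1 by case: (dYP n) => _ _ _; apply.
have Y0ae : absolute_extensor (dY 0).
  exact: (uniform_AR_absolute_extensor (dY_pm 0) (dY_1 0) (dY_m 0) (dY_s 0) hY0).
have Yce n : inhabited (Y n) -> cone_extensor (dY n).
  exact: (uniform_ANR_cone_extensor (dY_pm n) (dY_1 n) (dY_m n) (dY_s n) (hY n)).
have [r _] := uniform_AR_retraction (dY_pm 0) (dY_m 0) (dY_s 0) hY0.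
pose y0 : Y 0%N := r (fun=> 1).
split.
  exact: (ex_telescope_extension dX_pm dX_1 dX_m hp dY_pm dY_1 dY_m dY_s hq Y0ae Yce y0 hf).
move=> F G.
exact: (telescope_extensions_homotopic dX_pm dX_1 dX_m hp dY_pm dY_1 dY_m dY_s hq Y0ae Yce).
Qed.
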